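(* Let $S_\infty$ be the group of finitely supported permutations of $\mathbb{N}$ and $A_\infty\le S_\infty$ the subgroup of even permutations. Let $\omega$ be a non-principal ultrafilter on $\mathbb{N}$ and $(s_n)$ a scaling sequence. Up to bi-Lipschitz group isomorphism, $S_\infty$ and $A_\infty$ define the same asymptotic cone $\mathrm{Cone}_\omega(S_\infty,\|\cdot\|_{\mathrm{supp}})$ (with respect to $\omega$ and $(s_n)$), whether each group is equipped with the support norm or with any word norm generated by finitely many conjugacy classes. For all scaling sequences and all ultrafilters, $\mathrm{Cone}_\omega(S_\infty,\|\cdot\|_{\mathrm{supp}})$ is contractible as a topological space, and as a group it is simple and uniformly perfect of commutator length one (i.e. every element is a single commutator).
   Context: The support norm is $\|\sigma\|_{\mathrm{supp}}=|\{n\in\mathbb{N}:\sigma(n)\ne n\}|$. A word norm generated by finitely many conjugacy classes on a group $G$ is $g\mapsto\min\{m\ge0\mid g=t_1\cdots t_m,\ t_i\in T\}$, where $T=T^{-1}$ is a generating set of $G$ which is a union of finitely many conjugacy classes of $G$. Norms induce metrics $d(g,h)=\|gh^{-1}\|$. A scaling sequence is a sequence $(s_n)$ of positive reals with $\lim_\omega s_n=\infty$. A sequence $(x_n)$ in $G$ is admissible if $\|x_n\|/s_n$ is bounded. $\mathrm{Cone}_\omega(G,\|\cdot\|)$ is the set of admissible sequences modulo $(x_n)\sim(y_n)$ iff $\lim_\omega d(x_n,y_n)/s_n=0$, with metric $\lim_\omega d(x_n,y_n)/s_n$; since the norms here are conjugation invariant, it is a topological group under termwise multiplication. All ultrafilters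 are non-principal ultrafilters on $\mathbb{N}$. *)

(* Defs.v *)
From HB Require Import structures.
From mathcomp Require Import all_boot all_order all_algebra.
From mathcomp Require Import finmap.
From mathcomp Require Import all_classical all_reals all_analysis.

Set Implicit Arguments.
Unset Strict Implicit.
Unset Printing Implicit Defensive.

Import Order.TTheory GRing.Theory Num.Theory.
Import numFieldTopology.Exports numFieldNormedType.Exports.

Local Open Scope classical_set_scope.
Local Open Scope ring_scope.

Definition is_subgroup (G : groupType) (H : set G) : Prop :=
  [/\ H 1%g, forall x y, H x -> H y -> H (x * y)%g & forall x, H x -> H x^-1%g].

Definition is_normal_subgroup (G : groupType) (H : set G) : Prop :=
  is_subgroup H /\ forall x y, H x -> H (x ^ y)%g.

Definition simple_group (G : groupType) : Prop :=
  (exists g : G, g <> 1%g) /\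
  forall H : set G, is_normal_subgroup H -> H = [set 1%g] \/ H = [set: G].

Definition conj_class (G : groupType) (c : G) : set G :=
  [set (c ^ x)%g | x in [set: G]].

Record conj_norm (R : realType) (G : groupType) := ConjNorm {
  cnorm :> G -> R ;
  cnorm1 : cnorm 1%g = 0 ;
  cnorm_eq1 : forall g, cnorm g = 0 -> g = 1%g ;
  cnormV : forall g, cnorm g^-1%g = cnorm g ;
  cnormM : forall g h, cnorm (g * h)%g <= cnorm g + cnorm h ;
  cnormJ : forall g h, cnorm (g ^ h)%g = cnorm g }.

Section conj_norm_theory.
Context (R : realType) (G : groupType) (N : conj_norm R G).

Lemma cnorm_ge0 g : 0 <= N g.
Proof.
have := cnormM N g g^-1%g.
by rewrite mulgV cnorm1 cnormV -mulr2n pmulrn_lge0.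
Qed.

Lemma cnorm_divC g h : N (g / h)%g = N (h / g)%g.
Proof. by rewrite -cnormV invgF. Qed.

Lemma cnorm_div_trans h g k : N (g / k)%g <= N (g / h)%g + N (h / k)%g.
Proof. by rewrite (le_trans _ (cnormM N _ _))// mulgA mulgVK. Qed.

Lemma cnorm_mulC g h : N (g * h)%g = N (h * g)%g.
Proof. by rewrite -(cnormJ N (g * h)%g g) conjgE !mulgA mulVg mul1g. Qed.

Lemma cnorm_divMM a b c d :
  N (a * b / (c * d))%g <= N (a / c)%g + N (b / d)%g.
Proof.
rewrite invgM !mulgA cnorm_mulC !mulgA.
have -> : (c^-1 * a * b * d^-1 = (c^-1 * a) * (b * d^-1))%g by rewrite !mulgA.
by rewrite (le_trans (cnormM N _ _))// (cnorm_mulC c^-1%g).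
Qed.

Lemma cnorm_divVV a b : N (a^-1 / b^-1)%g = N (a / b)%g.
Proof. by rewrite invgK cnorm_mulC cnorm_divC. Qed.

End conj_norm_theory.

Record fin_conj_genset (G : groupType) := FinConjGenset {
  gens : set G ;
  gensV : [set t^-1%g | t in gens] = gens ;
  gens_gen : forall H : set G, is_subgroup H -> gens `<=` H -> H = [set: G] ;
  gens_conj : exists C : set G,
    finite_set C /\ gens = \bigcup_(c in C) conj_class c }.

Section word_norm.
Context (R : realType) (G : groupType) (T : fin_conj_genset G).

Definition is_word (g : G) (m : nat) : Prop :=
  exists t : seq G, [/\ size t = m, {in t, forall x, gens T x} &
                        g = (\prod_(x <- t) x)%g].

Lemma is_word1 : is_word 1%g 0.
Proof. by exists [::]; split => //; rewrite big_nil. Qed.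

Lemma is_wordM g h m n : is_word g m -> is_word h n -> is_word (g * h)%g (m + n).
Proof.
move=> [t [<- tT ->]] [u [<- uT ->]]; exists (t ++ u); split.
- by rewrite size_cat.
- by move=> x; rewrite mem_cat => /orP[/tT|/uT].
- by rewrite big_cat.
Qed.

Lemma gens_inv x : gens T x -> gens T x^-1%g.
Proof. by move=> Tx; rewrite -gensV; exists x. Qed.

Lemma gens_conjg x y : gens T x -> gens T (x ^ y)%g.
Proof.
have [C [_ TE]] := gens_conj T; rewrite TE => -[c Cc [z _ <-]].
by exists c => //; exists (z * y)%g => //; rewrite conjgM.
Qed.

Lemma is_wordV g m : is_word g m -> is_word g^-1%g m.
Proof.
move=> [t [<- tT ->]]; exists (rev [seq x^-1%g | x <- t]); split.
- by rewrite size_rev size_map.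
- by move=> x; rewrite mem_rev => /mapP[y yt ->]; exact/gens_inv/tT.
- by rewrite -map_rev big_map prodgV revK.
Qed.

Lemma is_wordJ g h m : is_word g m -> is_word (g ^ h)%g m.
Proof.
move=> [t [<- tT ->]]; exists [seq (x ^ h)%g | x <- t]; split.
- by rewrite size_map.
- by move=> x => /mapP[y yt ->]; exact/gens_conjg/tT.
- rewrite big_map; elim: t {tT} => [|x t IH]; first by rewrite !big_nil conj1g.
  by rewrite !big_cons conjMg IH.
Qed.

Lemma is_word_ex g : exists m, `[< is_word g m >].
Proof.
have subW : is_subgroup [set g | exists m, is_word g m].
  split => [|x y [m xm] [n yn]|x [m xm]].
  - by exists 0%N; exact: is_word1.
  - by exists (m + n)%N; exact: is_wordM.
  - by exists m; exact: is_wordV.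
have : [set: G] g by [].
rewrite -(@gens_gen _ T _ subW) => [[m gm]|x Tx]; first by exists m; apply/asboolP.
exists 1%N, [:: x]; split => //; last by rewrite big_seq1.
by move=> y; rewrite inE => /eqP ->.
Qed.

Definition word_length (g : G) : nat := ex_minn (is_word_ex g).

Lemma word_lengthP g : is_word g (word_length g).
Proof. by rewrite /word_length; case: ex_minnP => m /asboolP. Qed.

Lemma word_length_le g m : is_word g m -> (word_length g <= m)%N.
Proof.
by move=> gm; rewrite /word_length; case: ex_minnP => n _; apply; apply/asboolP.
Qed.

Lemma word_length_eq g h : (forall m, is_word g m <-> is_word h m) ->
  word_length g = word_length h.
Proof.
move=> gh; apply/eqP; rewrite eqn_leq.
by rewrite !word_length_le//; apply/gh; exact: word_lengthP.
Qed.

Let N (g : G) : R := (word_length g)%:R.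

Let N1 : N 1%g = 0.
Proof.
apply/eqP; rewrite pnatr_eq0 -leqn0; exact/word_length_le/is_word1.
Qed.

Let N_eq1 g : N g = 0 -> g = 1%g.
Proof.
move=> /eqP; rewrite pnatr_eq0 => /eqP g0.
have := word_lengthP g; rewrite g0 => -[t [/size0nil -> _ ->]].
by rewrite big_nil.
Qed.

Let NV g : N g^-1%g = N g.
Proof.
congr _%:R; apply: word_length_eq => m; split; last exact: is_wordV.
by move=> /is_wordV; rewrite invgK.
Qed.

Let NM g h : N (g * h)%g <= N g + N h.
Proof.
by rewrite -natrD ler_nat; apply: word_length_le; apply: is_wordM; exact: word_lengthP.
Qed.

Let NJ g h : N (g ^ h)%g = N g.
Proof.
congr _%:R; apply: word_length_eq => m; split; last exact: is_wordJ.
by move=> /(is_wordJ (h^-1)%g); rewrite conjgK.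
Qed.

Definition word_norm : conj_norm R G := ConjNorm N1 N_eq1 NV NM NJ.

End word_norm.

Definition moved (f : nat -> nat) : set nat := [set n | f n != n].

Definition fin_perm : set (nat -> nat) :=
  [set f | bijective f /\ finite_set (moved f)].

Record Sinf := MkSinf { Sinf_fun :> nat -> nat ; _ : Sinf_fun \in fin_perm }.

HB.instance Definition _ := [isSub for Sinf_fun].
HB.instance Definition _ := [Choice of Sinf by <:].

Section Sinf_group.
Implicit Types f g h : Sinf.

Lemma SinfP f : bijective f /\ finite_set (moved f).
Proof. by case: f => f /= /set_mem. Qed.

Lemma Sinf_eq f g : f =1 g -> f = g.
Proof. by move=> fg; apply/val_inj/funext. Qed.

Lemma fin_perm_id : id \in fin_perm.
Proof.
rewrite inE; split; first by exists id.
by rewrite (_ : moved _ = set0)// -subset0 => n; rewrite /moved/= eqxx.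
Qed.

Lemma moved_comp (f g : nat -> nat) : moved (f \o g) `<=` moved f `|` moved g.
Proof.
move=> n /=; rewrite /moved/= => fgn.
by have [gn|gn] := eqVneq (g n) n; [left; rewrite gn in fgn|right].
Qed.

Lemma fin_perm_comp f g : f \o g \in fin_perm.
Proof.
rewrite inE; have [[bf ff] [bg fg]] := (SinfP f, SinfP g).
split; first exact: bij_comp.
by apply: sub_finite_set (@moved_comp f g) _; rewrite finite_setU.
Qed.

Lemma fin_perm_inv_ex f :
  exists g : nat -> nat, [/\ cancel f g, cancel g f & g \in fin_perm].
Proof.
have [[g fK gK] ff] := SinfP f; exists g; split => //; rewrite inE; split.
  by exists f.
apply: sub_finite_set ff => n; rewrite /moved/=; apply: contra => /eqP fn.
by rewrite -{1}fn fK.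
Qed.

Definition Sinf_one : Sinf := MkSinf fin_perm_id.

(* Product of permutations is composition, (f * g) n = f (g n), contrary to the
   convention of {perm T}. *)
Definition Sinf_mul f g : Sinf := MkSinf (fin_perm_comp f g).

Definition Sinf_inv f : Sinf :=
  MkSinf (let: And3 _ _ gP := projT2 (cid (fin_perm_inv_ex f)) in gP).

Lemma Sinf_invK f : cancel f (Sinf_inv f).
Proof. by rewrite /Sinf_inv; case: cid => g []. Qed.

Lemma Sinf_invKV f : cancel (Sinf_inv f) f.
Proof. by rewrite /Sinf_inv; case: cid => g []. Qed.

Lemma Sinf_mulA : associative Sinf_mul. Proof. by move=> f g h; exact: Sinf_eq. Qed.
Lemma Sinf_mul1 : left_id Sinf_one Sinf_mul. Proof. by move=> f; exact: Sinf_eq. Qed.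
Lemma Sinf_1mul : right_id Sinf_one Sinf_mul. Proof. by move=> f; exact: Sinf_eq. Qed.
Lemma Sinf_mulV : left_inverse Sinf_one Sinf_inv Sinf_mul.
Proof. by move=> f; apply: Sinf_eq => n; exact: Sinf_invK. Qed.
Lemma Sinf_Vmul : right_inverse Sinf_one Sinf_inv Sinf_mul.
Proof. by move=> f; apply: Sinf_eq => n; exact: Sinf_invKV. Qed.

HB.instance Definition _ := isGroup.Build Sinf
  Sinf_mulA Sinf_mul1 Sinf_1mul Sinf_mulV Sinf_Vmul.

Lemma SinfM f g n : (f * g)%g n = f (g n). Proof. by []. Qed.

Lemma SinfJ f g n : (f ^ g)%g n = g^-1%g (f (g n)). Proof. by []. Qed.

Lemma Sinf1 n : (1%g : Sinf) n = n. Proof. by []. Qed.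

Lemma SinfKV f n : f^-1%g (f n) = n. Proof. exact: Sinf_invK. Qed.

Lemma SinfVK f n : f (f^-1%g n) = n. Proof. exact: Sinf_invKV. Qed.

End Sinf_group.

Section support_norm.
Context (R : realType).
Implicit Types f g h : Sinf.

(* [moved f] is finite, so [fset_set] enumerates it (it is empty on infinite
   sets). *)
Definition supp_size f : nat := #|` fset_set (moved f)|.

Let N f : R := (supp_size f)%:R.

Lemma moved_finite f : finite_set (moved f). Proof. by have [] := SinfP f. Qed.

Lemma supp_size_leJ f h : (supp_size (f ^ h)%g <= supp_size f)%N.
Proof.
rewrite /supp_size; have -> : moved (f ^ h)%g = h^-1%g @` moved f.
  rewrite eqEsubset; split => [n fhn|_ [n fn <-]].
    exists (h n); last by rewrite SinfKV.
    by move: fhn; apply: contra => /eqP fhn; rewrite SinfJ fhn SinfKV.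
  move: fn; apply: contra => /eqP; rewrite SinfJ SinfVK => /(congr1 h).
  by rewrite !SinfVK => ->.
rewrite fset_set_image; last exact: moved_finite.
exact: leq_imfset_card.
Qed.

Let N1 : N 1%g = 0.
Proof.
rewrite /N /supp_size (_ : moved _ = set0) ?fset_set0 ?cardfs0//.
by rewrite -subset0 => n; rewrite /moved/= eqxx.
Qed.

Let N_eq1 f : N f = 0 -> f = 1%g.
Proof.
move=> /eqP; rewrite pnatr_eq0 cardfs_eq0 => /eqP f0.
apply: Sinf_eq => n; apply/eqP/negP => fn.
have : n \in fset_set (moved f).
  by rewrite (in_fset_set (moved_finite f)) inE; exact/negP.
by rewrite f0.
Qed.

Let NV f : N f^-1%g = N f.
Proof.
rewrite /N /supp_size; congr (#|` fset_set _|)%:R.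
rewrite eqEsubset; split => n; apply: contra => /eqP fn.
  by rewrite -{1}fn SinfKV.
by rewrite -{1}fn SinfVK.
Qed.

Let NM f g : N (f * g)%g <= N f + N g.
Proof.
rewrite -natrD ler_nat /supp_size.
apply: leq_trans (leq_card_fsetU _ _).1.
rewrite -fset_setU; [|exact: moved_finite|exact: moved_finite].
apply: fsubset_leq_card; rewrite -fset_set_sub.
- exact: moved_comp.
- exact: moved_finite.
- by rewrite finite_setU; split; exact: moved_finite.
Qed.

Let NJ f h : N (f ^ h)%g = N f.
Proof.
congr _%:R; apply/eqP; rewrite eqn_leq supp_size_leJ/=.
by rewrite -{1}(conjgK h f) supp_size_leJ.
Qed.

Definition supp_norm : conj_norm R Sinf := ConjNorm N1 N_eq1 NV NM NJ.

End support_norm.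

Definition swap (a b n : nat) : nat :=
  if n == a then b else if n == b then a else n.

Lemma swapK a b : involutive (swap a b).
Proof.
move=> n; rewrite /swap/=; have [->|na] := eqVneq n a.
  by rewrite eqxx; case: eqVneq.
have [->|nb] := eqVneq n b; first by rewrite eqxx.
by rewrite (negbTE na) (negbTE nb).
Qed.

Lemma swap_fin_perm a b : swap a b \in fin_perm.
Proof.
rewrite inE; split; first exact/inv_bij/swapK.
apply: (@sub_finite_set _ _ [set a; b]); last exact: finite_set2.
move=> n; rewrite /moved/swap/=; have [->|na] := eqVneq n a; first by left.
by have [->|nb] := eqVneq n b; [right|rewrite eqxx].
Qed.

Definition transp (p : nat * nat) : Sinf := MkSinf (swap_fin_perm p.1 p.2).

(* {perm T} and its odd_perm need a finite T, hence the definition by an even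
   number of transpositions. *)
Definition even_Sinf : {pred Sinf} := [pred f |
  `[< exists s : seq (nat * nat),
        [/\ {in s, forall p, p.1 != p.2}, ~~ odd (size s) &
            f = (\prod_(p <- s) transp p)%g] >] ].

Lemma transpV p : (transp p)^-1%g = transp p.
Proof.
apply: (@mulgI _ (transp p)); rewrite mulgV.
by apply: Sinf_eq => n; rewrite SinfM /= swapK.
Qed.

Lemma even_Sinf_group_closed : group_closed even_Sinf.
Proof.
split.
  by apply/asboolP; exists [::]; split => //; rewrite big_nil.
move=> f g /asboolP[s [sP so ->]] /asboolP[t [tP te ->]]; apply/asboolP.
exists (s ++ rev t); split.
- by move=> p; rewrite mem_cat mem_rev => /orP[/sP|/tP].
- by rewrite size_cat size_rev oddD (negbTE so) (negbTE te).
- rewrite big_cat/= -{1}(revK t) -prodgV; congr (_ * _)%g.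
  by apply: eq_bigr => p _; rewrite transpV.
Qed.

Record Ainf := MkAinf { Ainf_val : Sinf ; _ : even_Sinf Ainf_val }.

HB.instance Definition _ := [isSub for Ainf_val].
HB.instance Definition _ := [Choice of Ainf by <:].
HB.instance Definition _ :=
  SubChoice_isSubGroup.Build Sinf even_Sinf Ainf even_Sinf_group_closed.

Section support_norm_Ainf.
Context (R : realType).
Implicit Types f g h : Ainf.

Let N f : R := supp_norm R (val f).

Lemma Ainf_valV f : val f^-1%g = (val f)^-1%g.
Proof. exact: gmulfV. Qed.

Let N1 : N 1%g = 0. Proof. by rewrite /N val1 cnorm1. Qed.
Let N_eq1 f : N f = 0 -> f = 1%g.
Proof. by move=> /cnorm_eq1 f1; apply: val_inj; rewrite f1 val1. Qed.
Let NV f : N f^-1%g = N f. Proof. by rewrite /N Ainf_valV cnormV. Qed.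
Let NM f g : N (f * g)%g <= N f + N g. Proof. by rewrite /N valM cnormM. Qed.
Let NJ f h : N (f ^ h)%g = N f.
Proof. by rewrite /N /conjg !valM Ainf_valV -[RHS](cnormJ _ _ (val h)). Qed.

Definition supp_norm_Ainf : conj_norm R Ainf := ConjNorm N1 N_eq1 NV NM NJ.

End support_norm_Ainf.

Record np_ultrafilter := NpUltrafilter {
  npuf :> set_system nat ;
  npuf_ultra : UltraFilter npuf ;
  npuf_nonprincipal : forall n : nat, npuf <> principal_filter n }.

#[global] Existing Instance npuf_ultra.

Record scaling_sequence (R : realType) (omega : np_ultrafilter) :=
  ScalingSequence {
  scaling :> nat -> R ;
  scaling_gt0 : forall n, 0 < scaling n ;
  scaling_cvg : scaling n @[n --> npuf omega] --> +oo }.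

Lemma ultra_bounded_cvg (R : realType) (F : set_system nat) (FU : UltraFilter F)
    (u : nat -> R) (a b : R) :
  (forall n, a <= u n <= b) -> cvg (u n @[n --> F]).
Proof.
move=> uab.
have FP : ProperFilter (u n @[n --> F]) by exact: fmap_proper_filter.
have [|p [_ clp]] := @segment_compact R a b (u n @[n --> F]) FP.
  by apply: (@filterE _ F _ (u @^-1` `[a, b])) => n; rewrite /= in_itv/= uab.
apply/cvg_ex; exists p => A pA.
have [//|FA] := in_ultra_setVsetC (u @^-1` A) FU.
by have [x [/= nAx]] := clp (~` A) A FA pA.
Qed.

Section cone.
Context (R : realType) (omega : np_ultrafilter) (s : scaling_sequence R omega).
Context (G : groupType) (N : conj_norm R G).

Definition admissible : set (nat -> G) :=
  [set x | exists M : R, forall n, N (x n) / s n <= M].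

Definition adm := set_type admissible.
HB.instance Definition _ := Choice.on adm.

Implicit Types x y z : adm.

Definition adm_seq x : nat -> G := val x.

Definition scaled_dist x y (n : nat) : R := N (adm_seq x n / adm_seq y n)%g / s n.

Definition cone_rel : rel adm :=
  fun x y => `[< scaled_dist x y n @[n --> npuf omega] --> (0 : R) >].

Lemma scaled_dist_ge0 x y n : 0 <= scaled_dist x y n.
Proof. by rewrite divr_ge0 ?cnorm_ge0// ltW// scaling_gt0. Qed.

Lemma scaled_distC x y : scaled_dist x y = scaled_dist y x.
Proof. by apply/funext => n; rewrite /scaled_dist cnorm_divC. Qed.

Lemma scaled_distxx x : scaled_dist x x = fun=> 0.
Proof. by apply/funext => n; rewrite /scaled_dist mulgV cnorm1 mul0r. Qed.

Lemma scaled_dist_triangle y x z n :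
  scaled_dist x z n <= scaled_dist x y n + scaled_dist y z n.
Proof.
rewrite /scaled_dist -mulrDl ler_pM2r ?invr_gt0 ?scaling_gt0//.
exact: cnorm_div_trans.
Qed.

Lemma admP x : exists M : R, forall n, N (adm_seq x n) / s n <= M.
Proof. exact: (set_mem (valP x)). Qed.

Lemma scaled_dist_cvg x y : cvg (scaled_dist x y n @[n --> npuf omega]).
Proof.
have [[M xM] [M' yM]] := (admP x, admP y).
apply: (@ultra_bounded_cvg _ _ _ _ 0 (M + M')) => n.
rewrite scaled_dist_ge0/= (le_trans _ (lerD (xM n) (yM n)))//.
rewrite /scaled_dist -mulrDl ler_pM2r ?invr_gt0 ?scaling_gt0//.
by rewrite (le_trans (cnormM N _ _))// cnormV.
Qed.

Lemma scaled_squeeze x y (u : nat -> R) : (forall n, scaled_dist x y n <= u n) ->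
  u n @[n --> npuf omega] --> (0 : R) -> cone_rel x y.
Proof.
move=> xyu u0; apply/asboolP; apply: squeeze_cvgr u0; last exact: cvg_cst.
by apply: nearW => n; rewrite scaled_dist_ge0 xyu.
Qed.

Lemma cone_rel_refl : reflexive cone_rel.
Proof. by move=> x; apply/asboolP; rewrite scaled_distxx; exact: cvg_cst. Qed.

Lemma cone_rel_sym : symmetric cone_rel.
Proof. by move=> x y; rewrite /cone_rel scaled_distC. Qed.

Lemma cone_rel_trans : transitive cone_rel.
Proof.
move=> y x z /asboolP xy /asboolP yz.
apply: (scaled_squeeze (scaled_dist_triangle y x z)).
by rewrite -[X in _ --> X]addr0; exact: cvgD xy yz.
Qed.

Canonical cone_equiv := EquivRel cone_rel cone_rel_refl cone_rel_sym cone_rel_trans.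

Definition Cone := {eq_quot cone_equiv}%qT.

HB.instance Definition _ := Choice.on Cone.
HB.instance Definition _ := EqQuotient.on Cone.

Definition cone_pi (x : adm) : Cone := \pi_Cone%qT x.

Lemma cone_piP x y : reflect (cone_pi x = cone_pi y) (cone_rel x y).
Proof. exact: (@eqmodP _ cone_equiv x y). Qed.

Lemma repr_cone_pi x : cone_rel (repr (cone_pi x)) x.
Proof. by apply/cone_piP; rewrite /cone_pi reprK. Qed.

Lemma adm_one_subproof : (fun=> 1%g) \in admissible.
Proof. by rewrite inE; exists 0 => n; rewrite cnorm1 mul0r. Qed.

Lemma adm_mul_subproof x y : (fun n => adm_seq x n * adm_seq y n)%g \in admissible.
Proof.
have [[M xM] [M' yM]] := (admP x, admP y); rewrite inE; exists (M + M') => n.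
rewrite (le_trans _ (lerD (xM n) (yM n)))//.
by rewrite -mulrDl ler_pM2r ?invr_gt0 ?scaling_gt0// cnormM.
Qed.

Lemma adm_inv_subproof x : (fun n => (adm_seq x n)^-1)%g \in admissible.
Proof. by have [M xM] := admP x; rewrite inE; exists M => n; rewrite cnormV. Qed.

Definition adm_one : adm := SigSub adm_one_subproof.
Definition adm_mul x y : adm := SigSub (adm_mul_subproof x y).
Definition adm_inv x : adm := SigSub (adm_inv_subproof x).

Definition cone_one : Cone := cone_pi adm_one.
(* The operations are computed on chosen representatives; [cone_mulE] and
   [cone_invE] show that they are the termwise ones. *)
Definition cone_mul (a b : Cone) : Cone := cone_pi (adm_mul (repr a) (repr b)).
Definition cone_inv (a : Cone) : Cone := cone_pi (adm_inv (repr a)).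

Lemma cone_mulE x y : cone_mul (cone_pi x) (cone_pi y) = cone_pi (adm_mul x y).
Proof.
apply/cone_piP; have /asboolP x0 := repr_cone_pi x.
have /asboolP y0 := repr_cone_pi y.
apply: (@scaled_squeeze _ _ (fun n => scaled_dist (repr (cone_pi x)) x n +
    scaled_dist (repr (cone_pi y)) y n)).
  move=> n; rewrite /scaled_dist -mulrDl ler_pM2r ?invr_gt0 ?scaling_gt0//.
  exact: cnorm_divMM.
by rewrite -[X in _ --> X]addr0; exact: cvgD x0 y0.
Qed.

Lemma cone_invE x : cone_inv (cone_pi x) = cone_pi (adm_inv x).
Proof.
apply/cone_piP; have /asboolP x0 := repr_cone_pi x.
apply: (scaled_squeeze _ x0) => n.
by rewrite /scaled_dist cnorm_divVV.
Qed.

Lemma cone_ind (P : Cone -> Prop) : (forall x, P (cone_pi x)) -> forall a, P a.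
Proof. by move=> Ppi a; rewrite -[a]reprK; exact: Ppi. Qed.

Lemma adm_eq x y : adm_seq x =1 adm_seq y -> x = y.
Proof. by move=> xy; apply/val_inj/funext. Qed.

Lemma cone_mulA : associative cone_mul.
Proof.
elim/cone_ind => x; elim/cone_ind => y; elim/cone_ind => z.
by rewrite !cone_mulE; congr cone_pi; apply: adm_eq => n; exact: mulgA.
Qed.

Lemma cone_mul1 : left_id cone_one cone_mul.
Proof.
elim/cone_ind => x.
by rewrite cone_mulE; congr cone_pi; apply: adm_eq => n; exact: mul1g.
Qed.

Lemma cone_1mul : right_id cone_one cone_mul.
Proof.
elim/cone_ind => x.
by rewrite cone_mulE; congr cone_pi; apply: adm_eq => n; exact: mulg1.
Qed.

Lemma cone_mulV : left_inverse cone_one cone_inv cone_mul.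
Proof.
elim/cone_ind => x; rewrite cone_invE.
by rewrite cone_mulE; congr cone_pi; apply: adm_eq => n; exact: mulVg.
Qed.

Lemma cone_Vmul : right_inverse cone_one cone_inv cone_mul.
Proof.
elim/cone_ind => x; rewrite cone_invE.
by rewrite cone_mulE; congr cone_pi; apply: adm_eq => n; exact: mulgV.
Qed.

HB.instance Definition _ := isGroup.Build Cone
  cone_mulA cone_mul1 cone_1mul cone_mulV cone_Vmul.

(* The limit exists by [scaled_dist_cvg]; independence of the representatives
   is [cone_distE]. *)
Definition cone_dist (a b : Cone) : R :=
  lim (scaled_dist (repr a) (repr b) n @[n --> npuf omega]).

Lemma cone_distE x y :
  cone_dist (cone_pi x) (cone_pi y) = lim (scaled_dist x y n @[n --> npuf omega]).
Proof.
have le x' y' x1 y1 : cone_rel x' x1 -> cone_rel y' y1 ->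
    lim (scaled_dist x' y' n @[n --> npuf omega]) <=
    lim (scaled_dist x1 y1 n @[n --> npuf omega]).
  move=> /asboolP xx1 /asboolP; rewrite scaled_distC => yy1.
  have c : scaled_dist x' x1 n + scaled_dist x1 y1 n + scaled_dist y1 y' n
      @[n --> npuf omega] --> lim (scaled_dist x1 y1 n @[n --> npuf omega]).
    rewrite -[X in _ --> X]addr0 -[X in X + 0]add0r.
    by apply: cvgD yy1; apply: cvgD xx1 _; exact: scaled_dist_cvg.
  rewrite -(cvg_lim _ c)//; apply: ler_lim; first exact: scaled_dist_cvg.
    by apply/cvg_ex; eexists; exact: c.
  apply: nearW => n; rewrite (le_trans (scaled_dist_triangle y1 x' y' n))//.
  by rewrite lerD2r scaled_dist_triangle.
by apply/eqP; rewrite eq_le /cone_dist !le//;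
  first [exact: repr_cone_pi|rewrite cone_rel_sym; exact: repr_cone_pi].
Qed.

Lemma cone_distxx a : cone_dist a a = 0.
Proof. by rewrite /cone_dist scaled_distxx lim_cst. Qed.

Lemma cone_dist_positivity a b : cone_dist a b = 0 -> a = b.
Proof.
move: a b; elim/cone_ind => x; elim/cone_ind => y; rewrite cone_distE => xy0.
by apply/cone_piP/asboolP; rewrite -xy0; exact: scaled_dist_cvg.
Qed.

Lemma cone_dist_sym a b : cone_dist a b = cone_dist b a.
Proof. by rewrite /cone_dist scaled_distC. Qed.

Lemma cone_dist_triangle b a c : cone_dist a c <= cone_dist a b + cone_dist b c.
Proof.
rewrite /cone_dist -limD; [|exact: scaled_dist_cvg|exact: scaled_dist_cvg].
apply: ler_lim; first exact: scaled_dist_cvg.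
  by apply: is_cvgD; exact: scaled_dist_cvg.
by apply: nearW => n; exact: scaled_dist_triangle.
Qed.

HB.instance Definition _ := isMetric.Build R Cone
  cone_distxx cone_dist_positivity cone_dist_sym cone_dist_triangle.

End cone.

(* A homotopy on [0,1] x T, encoded as a function on R x T that is continuous
   for the subspace topology of `[0, 1] `*` setT, from the identity to a
   constant map. *)
Definition contractible (R : realType) (T : topologicalType) : Prop :=
  exists (t0 : T) (H : R * T -> T),
    {within `[0, 1] `*` [set: T], continuous H} /\
    forall t, H (0, t) = t /\ H (1, t) = t0.

Definition bilipschitz (R : realType) (X Y : metricType R) (f : X -> Y) : Prop :=
  exists2 L : R, 0 < L &
    forall x x', L^-1 * mdist x x' <= mdist (f x) (f x') <= L * mdist x x'.

Definition same_cone (R : realType) (omega : np_ultrafilter)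
    (s : scaling_sequence R omega) (G G' : groupType)
    (N : conj_norm R G) (N' : conj_norm R G') : Prop :=
  exists f : Cone s N -> Cone s N',
    [/\ {morph f : x y / (x * y)%g}, bijective f & bilipschitz f].

(* Main.v *)
Require Import Defs.
From mathcomp Require Import all_boot all_order all_algebra.
From mathcomp Require Import finmap.
From mathcomp Require Import all_classical all_reals all_analysis.
From mathcomp Require Import zify lra.

(* All four comparisons of cones come from a homomorphism to [Sinf] which is
   bi-Lipschitz and almost onto: a permutation is a product of at most as many
   transpositions as the size of its support, and even permutations conjugate
   products of two transpositions into a finite set.

   Commutators: a cycle is the product of two reflections, and [ab = b (b^-1 a b)]
   allows one to balance the number of transpositions of the two factors over all
   cycles.  Every [f] is thus, up to one transposition, a product of two
   conjugate involutions supported in [supp f], hence a commutator.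

   Simplicity: if [g] displaces [A] from itself and [x], [y] are supported in [A]
   then [[~ [~ g, x], y] = [~ x, y]], and [A] may contain a third of [supp g].
   So a normal subgroup containing [g] contains all [f] with support at most a
   third of that of [g]; any [f] is a product of boundedly many such elements.

   Contractibility: deleting a point [p] from its cycle, [f |-> (p, f p) f], does
   not increase the Hamming distance.  Deleting the first [t |supp f]
   points of [supp f] is Lipschitz in [t] (relatively to [|supp f|]) and in [f],
   up to additive constants, which disappear in the cone. *)

Set Implicit Arguments.
Unset Strict Implicit.
Unset Printing Implicit Defensive.

Import Order.TTheory GRing.Theory Num.Theory.
Import numFieldTopology.Exports numFieldNormedType.Exports.

(** * Products of transpositions *)

Definition supp (f : Sinf) : {fset nat} := fset_set (moved f).

Section permutations.
Implicit Types (f g h : Sinf) (s t : seq nat) (P Q : seq (nat * nat)).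

Lemma mem_supp f n : (n \in supp f) = (f n != n).
Proof.
rewrite /supp in_fset_set; last exact: moved_finite.
by rewrite /moved; apply/idP/idP; rewrite inE.
Qed.

Lemma suppN f n : n \notin supp f -> f n = n.
Proof. by rewrite mem_supp negbK => /eqP. Qed.

Lemma supp_size_le f s : {subset supp f <= s} -> (supp_size f <= size s)%N.
Proof. by move=> fs; exact: uniq_leq_size. Qed.

Lemma le_supp_size f s : uniq s -> {subset s <= supp f} -> (size s <= supp_size f)%N.
Proof. by move=> us sf; exact: uniq_leq_size. Qed.

Lemma supp1 n : n \notin supp 1%g.
Proof. by rewrite mem_supp eqxx. Qed.

Lemma supp_size1 : supp_size 1%g = 0%N.
Proof.
apply/eqP; rewrite -leqn0; apply: (@supp_size_le _ [::]) => n.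
by rewrite (negPf (supp1 n)).
Qed.

Lemma suppV f n : (n \in supp f^-1%g) = (n \in supp f).
Proof.
rewrite !mem_supp; congr (~~ _); apply/eqP/eqP => e; rewrite -{1}e.
  exact: SinfVK.
exact: SinfKV.
Qed.

Lemma suppM f g n : n \in supp (f * g)%g -> (n \in supp f) || (n \in supp g).
Proof.
rewrite !mem_supp SinfM; apply: contraR; rewrite negb_or !negbK.
by case/andP => /eqP fn /eqP ->; rewrite fn.
Qed.

Lemma suppJ f g n : (n \in supp (f ^ g)%g) = (g n \in supp f).
Proof.
rewrite !mem_supp SinfJ; congr (~~ _); apply/eqP/eqP => [e|->].
  by rewrite -{2}e SinfVK.
exact: SinfKV.
Qed.

Lemma Sinf_inj f : injective f.
Proof. exact: can_inj (SinfKV f). Qed.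

Lemma supp_stable f n : (f n \in supp f) = (n \in supp f).
Proof. by rewrite !mem_supp (inj_eq (@Sinf_inj f)). Qed.

Lemma supp_stable_sub f g n : {subset supp f <= supp g} ->
  (f n \in supp g) = (n \in supp g).
Proof.
move=> fg; have [nf|/suppN -> //] := boolP (n \in supp f).
by rewrite !fg // supp_stable.
Qed.

Lemma supp_size0 f : supp_size f = 0%N -> f = 1%g.
Proof.
move=> /eqP; rewrite -leqn0 => f0; apply: Sinf_eq => n; apply: suppN.
have /eqP : supp f = fset0 by apply/eqP; rewrite -cardfs_eq0 -leqn0.
by move=> /eqP ->.
Qed.

Lemma disjoint_commute f g : {in supp f, forall n, n \notin supp g} ->
  (f * g = g * f)%g.
Proof.
move=> fg; apply: Sinf_eq => n; rewrite !SinfM.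
have [nf|nf] := boolP (n \in supp f).
  by rewrite (suppN (fg n nf)) [RHS]suppN// fg// supp_stable.
rewrite (suppN nf); have [ng|/suppN ->] := boolP (n \in supp g); last exact: suppN.
by apply: suppN; apply/negP => /fg; rewrite supp_stable ng.
Qed.

Lemma transpE (p : nat * nat) n :
  transp p n = if n == p.1 then p.2 else if n == p.2 then p.1 else n.
Proof. by []. Qed.

Lemma supp_transp (p : nat * nat) n : n \in supp (transp p) -> n \in [:: p.1; p.2].
Proof. rewrite mem_supp transpE !inE; case: (n =P p.1) => // _.
by case: (n =P p.2) => // _; rewrite eqxx. Qed.

Lemma transpJ (p : nat * nat) h :
  (transp p ^ h = transp (h^-1 p.1, h^-1 p.2))%g.
Proof.
apply: Sinf_eq => n; rewrite SinfJ !transpE /=.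
rewrite -[n in RHS](SinfKV h) !(inj_eq (@Sinf_inj h^-1%g)).
by case: eqP => // _; case: eqP.
Qed.

(** The values of [y] on [s] differ from [y a] and, [t] being duplicate-free, from [b]; so composing
    with the transposition of [y a] and [b] corrects the image of [a] alone. The support bound later
    keeps conjugators admissible. *)
Lemma seq_perm s t : uniq s -> uniq t -> size s = size t ->
  exists y : Sinf, map y s = t /\ {subset supp y <= s ++ t}.
Proof.
elim: s t => [|a s IH] [|b t] //=.
  by exists 1%g; split => // n; rewrite (negPf (supp1 n)).
move=> /andP[as_ us] /andP[bt ut] [] /IH -/(_ us ut)[y [yst ysupp]].
exists (transp (y a, b) * y)%g; split; last first.
  move=> n; have [/ysupp|ny] := boolP (n \in supp y).
    by rewrite !(mem_cat, inE) => /orP[] ->; rewrite ?orbT.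
  move=> /suppM; rewrite (negPf ny) orbF => /supp_transp.
  rewrite !inE /= -{1}(suppN ny) (inj_eq (@Sinf_inj y)) mem_cat !inE.
  by case/orP => ->; rewrite ?orbT.
congr cons; first by rewrite SinfM transpE eqxx.
rewrite -yst; apply/eq_in_map => x xs; rewrite SinfM transpE /=.
rewrite (inj_eq (@Sinf_inj y)); case: eqP => [xa|_]; first by rewrite -xa xs in as_.
by case: eqP => // yxb; move: bt; rewrite -yst -yxb map_f.
Qed.

Definition ptransp P : Sinf := (\prod_(p <- P) transp p)%g.

(** [uniq (ends P)] expresses that [P] consists of disjoint nondegenerate transpositions, so that
    [ptransp P] is an involution. *)
Definition ends P := unzip1 P ++ unzip2 P.

Lemma ptransp_cat P Q : ptransp (P ++ Q) = (ptransp P * ptransp Q)%g.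
Proof. exact: big_cat. Qed.

Lemma perm_ends_cat P Q : perm_eq (ends (P ++ Q)) (ends P ++ ends Q).
Proof. by rewrite /ends /unzip1 /unzip2 !map_cat perm_catACA. Qed.

Lemma perm_ends_cons (p : nat * nat) P :
  perm_eq (ends (p :: P)) (p.1 :: p.2 :: ends P).
Proof. by rewrite (perm_ends_cat [:: p] P). Qed.

Lemma supp_ptransp P : {subset supp (ptransp P) <= ends P}.
Proof.
elim: P => [|p P IH] n; first by rewrite /ptransp big_nil (negPf (supp1 n)).
rewrite /ptransp big_cons => /suppM; rewrite (perm_mem (perm_ends_cons _ _)).
case/orP => [/supp_transp|/IH]; rewrite !inE; first by rewrite orbA => ->.
by move=> ->; rewrite !orbT.
Qed.

Lemma ptransp_size P : (supp_size (ptransp P) <= (size P).*2)%N.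
Proof.
rewrite (leq_trans (supp_size_le (@supp_ptransp P)))// size_cat !size_map.
by rewrite addnn.
Qed.

Lemma ptranspV P : ((ptransp P)^-1 = ptransp (rev P))%g.
Proof. by rewrite -[P in LHS]revK -prodgV; apply: eq_bigr => p _; rewrite transpV. Qed.

Lemma perm_ends_rev P : perm_eq (ends (rev P)) (ends P).
Proof.
by rewrite /ends /unzip1 /unzip2 !map_rev; apply: perm_cat; rewrite perm_rev.
Qed.

Definition pmove (f : nat -> nat) P := [seq (f p.1, f p.2) | p <- P].

Lemma ends_pmove (f : nat -> nat) P : ends (pmove f P) = map f (ends P).
Proof. by rewrite /ends map_cat /unzip1 /unzip2 -!map_comp. Qed.

Lemma ptranspJ P h : (ptransp P ^ h = ptransp (pmove (h^-1)%g P))%g.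
Proof.
rewrite /ptransp big_map; elim: P => [|p P IH]; first by rewrite !big_nil conj1g.
by rewrite !big_cons conjMg IH transpJ.
Qed.

Lemma ptransp_conj P Q : uniq (ends P) -> uniq (ends Q) -> size P = size Q ->
  exists y : Sinf, (ptransp P ^ y = ptransp Q)%g /\
    {subset supp y <= ends P ++ ends Q}.
Proof.
move=> uP uQ PQ; have [|y [yPQ yS]] := seq_perm uP uQ.
  by rewrite /ends !size_cat !size_map PQ.
(* Since [x ^ y] is [y^-1 * x * y], it is conjugation by [y^-1] that moves endpoints by [y]. *)
exists y^-1%g; split; last by move=> n; rewrite suppV => /yS.
rewrite ptranspJ invgK; congr ptransp.
have /eqP : unzip1 (pmove y P) ++ unzip2 (pmove y P) = unzip1 Q ++ unzip2 Q.
  by rewrite -/(ends _) ends_pmove yPQ.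
rewrite eqseq_cat ?size_map// => /andP[/eqP e1 /eqP e2].
by rewrite -[LHS]zip_unzip e1 e2 zip_unzip.
Qed.

(** The first and last entries are exchanged and the middle is reversed by induction; a central
    entry stays fixed. *)
Lemma reflection_ptransp s : uniq s -> exists P,
  [/\ size P = (size s)./2, uniq (ends P), {subset ends P <= s} &
      forall i, (i < size s)%N ->
        ptransp P (nth 0%N s i) = nth 0%N s (size s - i.+1)].
Proof.
have [n] := ubnP (size s); elim: n s => // n IH [|x s] sn us.
  by exists [::].
case: (lastP s) sn us => [|{}s y] sn us.
  by exists [::]; split => // -[|i]//= _; rewrite /ptransp big_nil.
move: us; rewrite /= rcons_uniq mem_rcons inE negb_or => /andP[/andP[xy xs]].
move=> /andP[ys us].
have [|P [sP uP Ps Pn]] := IH s _ us; first by move: sn; rewrite /= size_rcons; lia.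
exists ((x, y) :: P); split.
- by rewrite /= sP size_rcons; lia.
- rewrite (perm_uniq (perm_ends_cons _ _)) /= uP inE negb_or xy andbT /=.
  by apply/andP; split; [move: xs|move: ys]; apply: contra => /Ps.
- move=> z; rewrite (perm_mem (perm_ends_cons _ _)) !inE mem_rcons inE.
  by case/or3P => [->|->|/Ps ->]; rewrite ?orbT.
have fixP z : z \notin s -> ptransp P z = z.
  by move=> zs; apply: suppN; apply: contra zs => /supp_ptransp /Ps.
move=> i; rewrite size_rcons ltnS /ptransp big_cons -/(ptransp P) SinfM.
case: i => [_|i isz] /=.
  by rewrite fixP// /swap eqxx /= nth_rcons ltnn eqxx.
rewrite !subSS nth_rcons.
have [il|il] := ltnP i (size s).
  rewrite Pn// -(subnSK il).
  have nz : nth 0%N s (size s - i.+1) \in s by rewrite mem_nth// ltn_subrL /= (leq_ltn_trans _ il).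
  rewrite /= nth_rcons /swap /=; case: ifPn => [/eqP e|_].
    by rewrite -e nz in xs.
  case: ifPn => [/eqP e|_]; first by rewrite -e nz in ys.
  by rewrite ltn_subrL /= (leq_ltn_trans _ il).
have -> : i = size s by apply/eqP; rewrite eqn_leq il -ltnS isz.
by rewrite eqxx subnn /= fixP// /swap eq_sym (negPf xy) eqxx.
Qed.
End permutations.

(** * Permutations as commutators *)

Section commutators.
Implicit Types (f g h : Sinf) (s t : seq nat) (P Q : seq (nat * nat)).

Lemma traject_supp f p n : p \in supp f -> {subset traject f p n <= supp f}.
Proof.
move=> pf x /trajectP[i _ ->]; elim: i => //= i; by rewrite supp_stable.
Qed.

(** For the largest [m] with distinct iterates, the next iterate repeats an earlier one; by
    injectivity of [f] this can only be [p]. *)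
Lemma orbit_seq f p : p \in supp f -> exists m,
  uniq (traject f p m.+1) /\ iter m.+1 f p = p.
Proof.
move=> pf.
have ex : exists m, uniq (traject f p m.+1) by exists 0%N.
have bd m : uniq (traject f p m.+1) -> (m <= supp_size f)%N.
  move=> um; rewrite -ltnS (leq_trans _ (leqnSn _))// -(size_traject f p m.+1).
  exact: le_supp_size um (traject_supp pf).
have [m um mmax] := ex_maxnP ex bd.
exists m; split => //; have : looping f p m.+1.
  by rewrite -[looping _ _ _]negbK -looping_uniq; apply/negP => /mmax; rewrite ltnn.
move=> /trajectP[[|i] im e]; first by [].
move: um; rewrite looping_uniq => /trajectP[]; exists i => //.
exact: (@Sinf_inj f).
Qed.

(* A cycle is the product of two reflections of the list of its points. *)
Lemma cycle_ptransp f p : p \in supp f -> exists P Q,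
  [/\ (size Q <= size P <= (size Q).+1)%N, uniq (ends P), uniq (ends Q) &
   [/\ {subset ends P <= supp (ptransp P * ptransp Q)%g},
      {subset ends Q <= supp (ptransp P * ptransp Q)%g},
      p \in supp (ptransp P * ptransp Q)%g &
      {in supp (ptransp P * ptransp Q)%g, (ptransp P * ptransp Q)%g =1 f}]].
Proof.
rewrite -suppV => pf; have [m [um em]] := orbit_seq pf.
(* The cycle is listed along [f^-1] as [s_0, ..., s_m]. [P] sends [s_j] to [s_(m-j)], and [Q],
   reversing the tail, sends [s_(i+1)] to [s_(m-i)]; so the product sends [s_(i+1)] to [s_i], and
   [s_0] to [s_m]. *)
pose g := (f^-1)%g; pose s := traject g p m.+1.
have sf : {subset s <= supp f}.
  by move=> x /(traject_supp pf); rewrite suppV.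
have [P [sP uP Ps Pn]] := reflection_ptransp um.
have ub : uniq (behead s) by case/andP: um.
have [Q [sQ uQ Qs Qn]] := reflection_ptransp ub.
have bs : {subset behead s <= s} by move=> x; rewrite inE => ->; rewrite orbT.
have ss : size s = m.+1 by rewrite size_traject.
have sb : size (behead s) = m by rewrite size_behead ss.
have gn i : (i <= m)%N -> nth 0%N s i = iter i g p.
  by move=> im; rewrite (set_nth_default p) ?ss// nth_traject.
have PQE : {in s, (ptransp P * ptransp Q)%g =1 f}.
  move=> x /(nthP 0%N)[i]; rewrite ss => im <-; rewrite SinfM.
  case: i im => [|i] im.
    rewrite (suppN (f := ptransp Q)); last first.
      by apply/negP => /supp_ptransp/Qs; case/andP: um => /negP.
    rewrite Pn ?ss// subn1 !gn//= -[p in RHS]em iterS /g.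
    by rewrite SinfVK.
  rewrite -[nth 0%N s i.+1]nth_behead Qn ?sb// !nth_behead.
  rewrite Pn ?ss ?ltnS; last by lia.
  rewrite !gn; [|lia|lia].
  rewrite /= SinfVK; congr (iter _ g p); lia.
have PQs : {subset supp (ptransp P * ptransp Q)%g <= s}.
  by move=> x /suppM /orP[/supp_ptransp/Ps|/supp_ptransp/Qs/bs].
have sc : {subset s <= supp (ptransp P * ptransp Q)%g}.
  by move=> x xs; rewrite mem_supp PQE// -mem_supp sf.
exists P, Q; split => //; first by rewrite sP sQ size_traject sb; lia.
split => [x /Ps/sc|x /Qs/bs/sc||x /PQs/PQE] //.
by rewrite sc// inE eqxx.
Qed.

(** [P'] is [P] conjugated by [ptransp Q]; this permutation is supported in [supp f], so the
    endpoints of [P'] stay there. *)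
Lemma ptransp_flip f P Q : f = (ptransp P * ptransp Q)%g -> uniq (ends P) ->
  {subset ends P <= supp f} -> {subset ends Q <= supp f} ->
  exists P', [/\ f = (ptransp Q * ptransp P')%g, size P' = size P,
                 uniq (ends P') & {subset ends P' <= supp f}].
Proof.
move=> fE uP Pf Qf; pose b := ((ptransp Q)^-1)%g.
exists (pmove b P); rewrite -ptranspJ size_map ends_pmove; split => //.
- by rewrite conjgE !mulgA mulgV mul1g.
- by rewrite map_inj_uniq//; exact: Sinf_inj.
- move=> _ /mapP[x /Pf xf ->]; rewrite supp_stable_sub// => n.
  by rewrite suppV => /supp_ptransp/Qf.
Qed.

(** A cycle [c] is split off; the rest [f'] has disjoint support, so its first factor commutes past
    the second factor of [c]. *)
Lemma balanced_ptransp f : exists P Q,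
  [/\ (size Q <= size P <= (size Q).+1)%N, uniq (ends P), uniq (ends Q) &
   [/\ {subset ends P <= supp f}, {subset ends Q <= supp f} &
      f = (ptransp P * ptransp Q)%g]].
Proof.
have [n] := ubnP (supp_size f); elim: n f => // n IH f fn.
have [/supp_size0 ->|] := posnP (supp_size f).
  by exists [::], [::]; split => //; split => //; rewrite /ptransp !big_nil mulg1.
rewrite cardfs_gt0 => /fset0Pn[p pf].
have [P [Q [sPQ uP uQ]]] := cycle_ptransp pf.
set c := (ptransp P * ptransp Q)%g => -[Pc Qc pc cE].
have cf : {subset supp c <= supp f}.
  by move=> x xc; rewrite mem_supp -cE// -mem_supp.
pose f' := (c^-1 * f)%g.
have ff' : f = (c * f')%g by rewrite mulVKg.
have f'c : {in supp f', forall x, x \notin supp c}.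
  move=> x; rewrite mem_supp SinfM; apply: contra => xc.
  by rewrite -cE// SinfKV.
have f'f : {subset supp f' <= supp f}.
  by move=> x /suppM; rewrite suppV => /orP[/cf|].
have [|P' [Q' [sPQ' uP' uQ' [Pf' Qf' E']]]] := IH f'.
  rewrite ltnS in fn; rewrite (leq_trans _ fn)//.
  apply: (@le_supp_size f (p :: supp f')) => [|x].
    rewrite /= fset_uniq andbT; apply/negP => /f'c; by rewrite pc.
  by rewrite inE => /predU1P[->|/f'f].
have dis A B : {subset ends A <= supp c} -> {subset ends B <= supp f'} ->
    uniq (ends A) -> uniq (ends B) ->
    uniq (ends (A ++ B)) /\ {subset ends (A ++ B) <= supp f}.
  move=> Ac Bf uA uB; rewrite (perm_uniq (perm_ends_cat _ _)) cat_uniq uA uB andbT.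
  split; first by apply/hasPn => x /Bf/f'c; apply: contra => /Ac.
  move=> x; rewrite (perm_mem (perm_ends_cat _ _)) mem_cat.
  by case/orP => [/Ac/cf|/Bf/f'f].
have mix A B : f' = (ptransp A * ptransp B)%g -> {subset ends A <= supp f'} ->
    f = (ptransp (P ++ A) * ptransp (Q ++ B))%g.
  move=> E Af; rewrite ff' E !ptransp_cat !mulgA; congr (_ * _)%g.
  rewrite -!mulgA; congr (_ * _)%g; apply: disjoint_commute.
  by move=> x /supp_ptransp/Qc xc; apply/negP => /supp_ptransp/Af/f'c; rewrite xc.
have [P1 [Q1 [s1 uP1 uQ1 [P1f Q1f E1]]]] : exists P1 Q1,
  [/\ (size Q + size Q1 <= size P + size P1 <= (size Q + size Q1).+1)%N,
    uniq (ends P1), uniq (ends Q1) &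
    [/\ {subset ends P1 <= supp f'}, {subset ends Q1 <= supp f'} &
      f' = (ptransp P1 * ptransp Q1)%g]].
  (* Each pair has excess 0 or 1. The total is too large only if both are 1, and then flipping the
     factors of [f'] makes it 0. *)
  have [sle|slt] := leqP (size P + size P') (size Q + size Q').+1.
    by exists P', Q'; split => //; lia.
  have [P2 [E2 s2 u2 f2]] := ptransp_flip E' uP' Pf' Qf'.
  by exists Q', P2; split => //; lia.
have [uP2 P2f] := dis _ _ Pc P1f uP uP1.
have [uQ2 Q2f] := dis _ _ Qc Q1f uQ uQ1.
exists (P ++ P1), (Q ++ Q1); rewrite !size_cat; split => //; split => //.
exact: mix.
Qed.

Lemma near_commutator f : exists x y : Sinf,
  [/\ {subset supp x <= supp f}, {subset supp y <= supp f} &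
      (supp_size (f / [~ x, y])%g <= 2)%N].
Proof.
have [P [Q [sPQ uP uQ [Pf Qf fE]]]] := balanced_ptransp f.
(* The error [e] is the first transposition of [P] if [P] is longer than [Q], and 1 otherwise. *)
have [P0 [e [fe e2 [P0f uP0 sP0]]]] : exists P0 e,
  [/\ f = (e * ptransp P0 * ptransp Q)%g, (supp_size e <= 2)%N &
  [/\ {subset ends P0 <= supp f}, uniq (ends P0) & size P0 = size Q]].
  have [eq|neq] := eqVneq (size P) (size Q).
    exists P, 1%g; rewrite mul1g; by rewrite supp_size1; split.
  case: P fE sPQ uP Pf neq => [|p P] fE sPQ uP Pf neq.
    by move: sPQ neq; rewrite /=; lia.
  exists P, (transp p); split; first by rewrite fE /ptransp big_cons.
    exact: supp_size_le (@supp_transp p).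
  have me := perm_mem (perm_ends_cons p P); split.
  - by move=> x xP; rewrite Pf// me !inE xP !orbT.
  - by move: uP; rewrite (perm_uniq (perm_ends_cons p P)) => /and3P[].
  - by move: sPQ neq; rewrite /=; lia.
have [||y [yPQ yS]] := @ptransp_conj (rev P0) Q _ uQ.
- by rewrite (perm_uniq (perm_ends_rev _)).
- by rewrite size_rev.
(* [[~ x, y]] is [x^-1 * x ^ y], which here becomes [ptransp P0 * ptransp Q]. *)
exists (ptransp P0)^-1%g, y; split.
- by move=> x; rewrite suppV => /supp_ptransp/P0f.
- by move=> x /yS; rewrite mem_cat (perm_mem (perm_ends_rev _)) => /orP[/P0f|/Qf].
- by rewrite commgEl invgK ptranspV yPQ fe -(mulgA e) mulgK.
Qed.

End commutators.

(** * Double commutators with a displacing element *)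

Section displacement.
Implicit Types (f g h : Sinf) (s t : seq nat).

Lemma supp_sizeV f : supp_size f^-1%g = supp_size f.
Proof.
by apply/eqP; rewrite eqn_leq !supp_size_le// => n; rewrite suppV.
Qed.

Lemma supp_sizeJ f h : supp_size (f ^ h)%g = supp_size f.
Proof.
by apply/eqP; rewrite eqn_leq supp_size_leJ -{1}(conjgK h f) supp_size_leJ.
Qed.

Lemma supp_sizeM f g : (supp_size (f * g)%g <= supp_size f + supp_size g)%N.
Proof.
rewrite -size_cat; apply: supp_size_le => n /suppM; by rewrite mem_cat.
Qed.

(** Greedy choice: selecting [x] rules out only [g x] and [g^-1 x], so each selection uses up at
    most three points. *)
Lemma displaced_seq g s : uniq s -> {subset s <= supp g} -> exists t,
  [/\ uniq t, {subset t <= s}, {in t, forall x, g x \notin t} &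
      (size s <= 3 * size t)%N].
Proof.
have [n] := ubnP (size s); elim: n s => // n IH [|x s] /= sn us sg.
  by exists [::].
case/andP: us => xs us.
pose P := [pred y | (y != g x) && (y != g^-1%g x)].
have sP : (size s <= size (seq.filter P s) + 2)%N.
  rewrite size_filter -(count_predC P) leq_add2l.
  rewrite (leq_trans (n := count (pred1 (g x)) s + count (pred1 (g^-1%g x)) s))//.
    rewrite -count_predUI (leq_trans _ (leq_addr _ _))//; apply: sub_count => y /=.
    by rewrite negb_and !negbK.
  by rewrite !count_uniq_mem//; do 2 case: (_ \in _).
have [||y yP|t [ut ts tg st]] := IH (seq.filter P s).
- by rewrite ltnS in sn; rewrite (leq_ltn_trans _ sn)// size_filter count_size.
- exact: filter_uniq.
- by move: yP; rewrite seq.mem_filter => /andP[_ ys]; apply: sg; rewrite inE ys orbT.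
exists (x :: t); split.
- rewrite /= ut andbT; apply: contra xs => /ts; by rewrite seq.mem_filter => /andP[].
- move=> y; rewrite !inE => /predU1P[->|/ts]; first by rewrite eqxx.
  by rewrite seq.mem_filter => /andP[_ ->]; rewrite orbT.
- have gx : g x != x by rewrite -mem_supp sg// inE eqxx.
  move=> y; rewrite !inE negb_or => /predU1P[->|yt].
    by rewrite gx; apply/negP => /ts; rewrite seq.mem_filter /= eqxx.
  rewrite tg// andbT; apply/negP => /eqP e; move/ts: yt.
  by rewrite seq.mem_filter /P inE -e SinfKV eqxx andbF.
- by rewrite /= mulnS ltnS (leq_trans sP)// addnC leq_add2l.
Qed.

(* If [x] and [y] live on a set [A] displaced by [g], then [x^-1 ^ g] commutes
   with both, so that [[~ [~ g, x], y]] reduces to [[~ x, y]]. *)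
Lemma near_double_commutator f g : (3 * supp_size f <= supp_size g)%N ->
  exists x y z : Sinf,
  [/\ (supp_size x <= supp_size f)%N, (supp_size y <= supp_size f)%N,
      (supp_size z <= 2 * supp_size f)%N &
      (supp_size (f / [~ [~ g, x], y] ^ z)%g <= 2)%N].
Proof.
move=> fg; have [x0 [y0 [x0f y0f fxy]]] := near_commutator f.
have [A [uA Ag gA sA]] := @displaced_seq g (supp g) (fset_uniq _) (fun=> id).
have fA : (supp_size f <= size A)%N by rewrite -(leq_pmul2l (isT : (0 < 3)%N)) (leq_trans fg).
(* [w] carries [supp f] into the displaced set [A]; the commutator is formed there and conjugated
   back by [w]. *)
have [||w [wfA wS]] := @seq_perm (supp f) (take (supp_size f) A) (fset_uniq _).
- exact: take_uniq.
- by rewrite size_takel.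
have toA h : {subset supp h <= supp f} -> {subset supp (h ^ w^-1)%g <= A}.
  move=> hf n; rewrite suppJ => /hf /(map_f w); rewrite SinfVK wfA.
  exact: mem_take.
have xA := toA _ x0f; have yA := toA _ y0f.
set x := (x0 ^ w^-1)%g in xA; set y := (y0 ^ w^-1)%g in yA.
have dis h : {subset supp h <= A} -> commute (x^-1 ^ g)%g h.
  move=> hA; apply: disjoint_commute => n; rewrite suppJ suppV => /xA gnA.
  by apply/negP => /hA/gA; rewrite gnA.
have gxy : ([~ [~ g, x], y] = [~ x, y])%g.
  rewrite [[~ g, x]%g]commgEr; set u := (x^-1 ^ g)%g in dis *.
  have -> : (x^-1 ^ g * x)%g = (u * x)%g by [].
  have uy : (u ^ y = u)%g by apply/conjg_fixP/commgP; exact: dis.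
  by rewrite !commgEl conjMg uy invgM -mulgA mulKg.
exists x, y, w; rewrite !supp_sizeJ; split.
- exact: supp_size_le.
- exact: supp_size_le.
- by rewrite (leq_trans (supp_size_le wS))// size_cat size_takel// addnn mul2n leqnn.
- by rewrite gxy conjRg !conjgKV.
Qed.

(** * Deleting one point, and decomposition into transpositions *)

Definition remove (p : nat) f : Sinf := (transp (p, f p) * f)%g.

Lemma removeE p f n :
  remove p f n = if f n == p then f p else if n == p then p else f n.
Proof.
by rewrite /remove SinfM transpE /= (inj_eq (@Sinf_inj f)).
Qed.

Lemma supp_remove p f n : n \in supp (remove p f) -> (n != p) && (n \in supp f).
Proof.
rewrite !mem_supp removeE; case: (eqVneq n p) => [->|np].
  by case: (f p =P p) => [e|_]; rewrite ?e eqxx.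
by case: (eqVneq (f n) p) => [-> _|//]; rewrite eq_sym.
Qed.

(** Removing a point of the support shrinks the support and is undone by one transposition. *)
Lemma transp_decomposition f : exists P,
  [/\ (size P <= supp_size f)%N, {in P, forall p, p.1 != p.2} & f = ptransp P].
Proof.
have [n] := ubnP (supp_size f); elim: n f => // n IH f fn.
have [/supp_size0 ->|] := posnP (supp_size f).
  by exists [::]; split => //; rewrite /ptransp big_nil.
rewrite cardfs_gt0 => /fset0Pn[p pf].
have lt : (supp_size (remove p f) < supp_size f)%N.
  apply: (@le_supp_size f (p :: supp (remove p f))) => [|x].
    rewrite /= fset_uniq andbT; by apply/negP => /supp_remove; rewrite eqxx.
  by rewrite inE => /predU1P[->|/supp_remove/andP[]].
have [|P [sP nP E]] := IH (remove p f); first by rewrite (leq_trans lt).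
exists ((p, f p) :: P); split => /=.
- exact: leq_ltn_trans lt.
- by move=> q; rewrite inE => /predU1P[->|/nP//]; rewrite eq_sym -mem_supp.
- by rewrite /ptransp big_cons -/(ptransp P) -E -[X in (X * _)%g]transpV mulKg.
Qed.

End displacement.

(** * Deleting points from cycles *)

Section truncation.
Implicit Types (f g h : Sinf).

Lemma mem_supp_diff f g n : (n \in supp (g^-1 * f)%g) = (f n != g n).
Proof.
rewrite mem_supp SinfM; congr (~~ _); apply/eqP/eqP => [e|->].
  by rewrite -{2}e SinfVK.
exact: SinfKV.
Qed.

(* Where [f] and [g] disagree at [p], the point [f^-1 p] may become a new
   disagreement, but [p] no longer is one. *)
Lemma remove_lipschitz p f g :
  (supp_size ((remove p g)^-1 * remove p f)%g <= supp_size (g^-1 * f)%g)%N.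
Proof.
have [fg|fg] := eqVneq (f p) (g p).
  apply: supp_size_le => n; rewrite !mem_supp_diff; apply: contra => /eqP e.
  by rewrite !removeE e fg.
have pD : p \in supp (g^-1 * f)%g by rewrite mem_supp_diff.
pose D := rem p (supp (g^-1 * f)%g).
have sD : supp_size (g^-1 * f)%g = size (f^-1%g p :: D).
  by rewrite /= size_rem// prednK// cardfs_gt0; apply/fset0Pn; exists p.
rewrite sD; apply: supp_size_le => n; rewrite mem_supp_diff !removeE inE.
case: (eqVneq n (f^-1%g p)) => [//|nfp]; rewrite orFb.
have fnp : (f n == p) = false.
  by apply: contra_neqF nfp => /eqP <-; rewrite SinfKV.
rewrite fnp; have [->|np] := eqVneq n p.
  by case: (g p =P p) => [e|_]; rewrite ?e eqxx.
rewrite mem_rem_uniq ?fset_uniq// inE np mem_supp_diff.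
by apply: contra => /eqP <-; rewrite fnp.
Qed.

Lemma transp_id p : (transp (p, p) = 1)%g.
Proof. by apply: Sinf_eq => n; rewrite transpE /=; case: eqP. Qed.

(** The points removed are [0, ..., c-1] whatever [f] is, so [remove_lipschitz] can be iterated at a
    common cut; removing a point off the support changes nothing. *)
Fixpoint trunc (c : nat) f : Sinf := if c is c'.+1 then remove c' (trunc c' f) else f.

Lemma supp_trunc c f n : n \in supp (trunc c f) -> (c <= n)%N && (n \in supp f).
Proof.
elim: c => [|c IH] //= /supp_remove/andP[nc /IH/andP[cn ->]].
by rewrite andbT ltn_neqAle eq_sym nc.
Qed.

Definition supp_count f (c : nat) : nat := count (mem (supp f)) (iota 0 c).

Lemma supp_countS f c : supp_count f c.+1 = (supp_count f c + (c \in supp f))%N.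
Proof. by rewrite /supp_count -addn1 iotaD count_cat /= addn0. Qed.

Lemma leq_supp_count f c d : (c <= d)%N -> (supp_count f c <= supp_count f d)%N.
Proof.
move=> cd; rewrite -(subnKC cd); elim: (d - c)%N => [|k IH]; first by rewrite addn0.
by rewrite addnS supp_countS (leq_trans IH)// leq_addr.
Qed.

Lemma supp_count_le f c : (supp_count f c <= supp_size f)%N.
Proof.
rewrite /supp_count -size_filter; apply: le_supp_size.
  by rewrite filter_uniq// iota_uniq.
by move=> n; rewrite seq.mem_filter => /andP[].
Qed.

Lemma supp_count_max f : exists c, supp_count f c = supp_size f.
Proof.
exists (\max_(n <- supp f) n).+1; apply/eqP; rewrite eqn_leq supp_count_le /=.
rewrite /supp_count -size_filter; apply: supp_size_le => n nf.
rewrite seq.mem_filter mem_iota /= nf ltnS.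
exact: (leq_bigmax_seq (F := id)).
Qed.

Lemma supp_size_diffC f g : supp_size (g^-1 * f)%g = supp_size (f^-1 * g)%g.
Proof. by rewrite -supp_sizeV invgM invgK. Qed.

Lemma supp_size_diff_trans h f g :
  (supp_size (g^-1 * f)%g <= supp_size (g^-1 * h)%g + supp_size (h^-1 * f)%g)%N.
Proof.
have -> : (g^-1 * f = (g^-1 * h) * (h^-1 * f))%g by rewrite -mulgA mulVKg.
exact: supp_sizeM.
Qed.

(** A point moved by [f] is moved by [g] as well unless [f] and [g] disagree there. *)
Lemma supp_count_diff f g c :
  (supp_count f c <= supp_count g c + supp_size (g^-1 * f)%g)%N.
Proof.
apply: leq_trans (leq_add (leqnn _) (supp_count_le _ c)).
rewrite /supp_count -count_predUI (leq_trans _ (leq_addr _ _))//.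
apply: sub_count => n /=; rewrite !mem_supp_diff !mem_supp.
by case: (eqVneq (g n) n) => [->|].
Qed.

Lemma supp_size_diff f g : (supp_size f <= supp_size g + supp_size (g^-1 * f)%g)%N.
Proof. by rewrite -[f in X in (X <= _)%N](mulVKg g) supp_sizeM. Qed.

Lemma trunc_lipschitz c f g :
  (supp_size ((trunc c g)^-1 * trunc c f)%g <= supp_size (g^-1 * f)%g)%N.
Proof.
by elim: c => //= c IH; exact: leq_trans (remove_lipschitz _ _ _) IH.
Qed.

Lemma trunc_step c f :
  (supp_size ((trunc c.+1 f)^-1 * trunc c f)%g <= 2 * (c \in supp f))%N.
Proof.
rewrite /= /remove; set h := trunc c f.
have -> : ((transp (c, h c) * h)^-1 * h = transp (c, h c) ^ h)%g.
  by rewrite invgM transpV conjgE mulgA.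
rewrite supp_sizeJ; have [cf|cf] := boolP (c \in supp f).
  exact: supp_size_le (@supp_transp (c, h c)).
have -> : h c = c.
  by apply: suppN; apply: contra cf => /supp_trunc/andP[].
by rewrite transp_id supp_size1.
Qed.

Lemma trunc_dist c d f : (c <= d)%N ->
  (supp_size ((trunc d f)^-1 * trunc c f)%g
     <= 2 * (supp_count f d - supp_count f c))%N.
Proof.
move=> cd; rewrite -(subnKC cd); elim: (d - c)%N => [|k IH].
  by rewrite addn0 mulVg supp_size1.
have m := leq_supp_count f (leq_addr k c).
rewrite addnS (leq_trans (supp_size_diff_trans (trunc (c + k) f) _ _))//.
rewrite (leq_trans (leq_add (trunc_step _ _) IH))// supp_countS.
rewrite -mulnDr leq_mul2l /=; lia.
Qed.

End truncation.

(** * Deleting a given proportion of the support *)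

Section contraction.
Context (R : realType).
Implicit Types (f g : Sinf) (t u : R).
Local Open Scope ring_scope.

(** Clamping extends the homotopy to all real times, so that continuity can be proved on the whole
    product. *)
Definition clamp01 t : R := Num.max 0 (Num.min t 1).

Lemma clamp01P t : 0 <= clamp01 t <= 1.
Proof. by rewrite /clamp01 le_max lexx ge_max ler01 ge_min lexx orbT. Qed.

Lemma clamp01_lipschitz t u : `|clamp01 t - clamp01 u| <= `|t - u|.
Proof.
have := ler_norm (t - u); have := ler_norm (u - t); rewrite (distrC u t) => ? ?.
rewrite ler_norml /clamp01 /Num.max /Num.min; apply/andP.
by case: (ltP t 1) => ?; case: (ltP u 1) => ?; do 2 case: ltP => ?; split; lra.
Qed.

Lemma cut_ex t f : exists c,
  clamp01 t * (supp_size f)%:R <= (supp_count f c)%:R :> R.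
Proof.
have [c e] := supp_count_max f; exists c; rewrite e ler_piMl//.
by case/andP: (clamp01P t).
Qed.

(* The initial segment below [cut t f] contains a proportion [t] of the support
   of [f]. *)
Definition cut t f : nat := ex_minn (cut_ex t f).

Lemma cut_ge t f : clamp01 t * (supp_size f)%:R <= (supp_count f (cut t f))%:R :> R.
Proof. by rewrite /cut; case: ex_minnP. Qed.

(** By minimality the count just before the cut is below the target, and one more point adds at most
    1. *)
Lemma cut_le t f :
  (supp_count f (cut t f))%:R <= clamp01 t * (supp_size f)%:R + 1 :> R.
Proof.
rewrite /cut; case: ex_minnP => -[|c] _ cmin.
  by rewrite addr_ge0// mulr_ge0//; case/andP: (clamp01P t).
have : ~~ (clamp01 t * (supp_size f)%:R <= (supp_count f c)%:R :> R).
  by apply/negP => /cmin; rewrite ltnn.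
rewrite -ltNge => /ltW lt; rewrite supp_countS natrD lerD//.
by rewrite (ler_nat _ _ 1) leq_b1.
Qed.

Definition shrink t f : Sinf := trunc (cut t f) f.

Lemma supp_shrink t f : {subset supp (shrink t f) <= supp f}.
Proof. by move=> n /supp_trunc/andP[]. Qed.

Lemma shrink0 f : shrink 0 f = f.
Proof.
rewrite /shrink /cut; case: ex_minnP => c _ cmin.
have -> // : c = 0%N; apply/eqP; rewrite -leqn0; apply: cmin.
by rewrite /clamp01 min_l// maxxx mul0r.
Qed.

Lemma shrink1 f : shrink 1 f = 1%g.
Proof.
have := cut_ge 1 f; rewrite /clamp01 minxx max_r// mul1r ler_nat => le.
apply: Sinf_eq => n; apply: suppN; apply/negP => /supp_trunc/andP[cn nf].
have := leq_trans (leq_trans (leq_supp_count f cn) (leqnn _)) (leqnn _).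
move=> /(leq_trans le); have := supp_count_le f n.+1; rewrite supp_countS nf.
by lia.
Qed.

Lemma trunc_dist_le c d f : (supp_size ((trunc d f)^-1 * trunc c f)%g)%:R
  <= 2 * `|(supp_count f d)%:R - (supp_count f c)%:R| :> R.
Proof.
wlog cd : c d / (c <= d)%N => [W|].
  case/orP: (leq_total c d) => [/W//|/W].
  by rewrite supp_size_diffC distrC.
rewrite -natrB ?leq_supp_count// normr_nat -natrM ler_nat; exact: trunc_dist.
Qed.

(** Cutting both at the cut [c] of [f] costs [k]. Moving the cut of [g] from [c] to [d] costs twice
    the number of points of [supp g] in between, at most [2 * k + |t - u| * S' + 1]: one [k] for
    counting in [supp g] instead of [supp f], one for replacing [S] by [S'], and 1 for rounding. *)
Lemma shrink_lipschitz t u f g :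
  (supp_size ((shrink u g)^-1 * shrink t f)%g)%:R <=
  5 * (supp_size (g^-1 * f)%g)%:R + 2 * `|t - u| * (supp_size g)%:R + 6 :> R.
Proof.
set k := (supp_size (g^-1 * f)%g)%:R.
set c := cut t f; set d := cut u g; rewrite /shrink -/c -/d.
have h1 : (supp_size ((trunc d g)^-1 * trunc c f)%g)%:R <=
    (supp_size ((trunc d g)^-1 * trunc c g)%g)%:R + k :> R.
  rewrite -natrD ler_nat (leq_trans (supp_size_diff_trans (trunc c g) _ _))//.
  by rewrite leq_add2l trunc_lipschitz.
apply: (le_trans h1); have h2 := trunc_dist_le c d g.
have a1 : (supp_count f c)%:R <= (supp_count g c)%:R + k :> R.
  by rewrite -natrD ler_nat supp_count_diff.
have a2 : (supp_count g c)%:R <= (supp_count f c)%:R + k :> R.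
  by rewrite /k supp_size_diffC -natrD ler_nat supp_count_diff.
have b1 : (supp_size f)%:R <= (supp_size g)%:R + k :> R.
  by rewrite -natrD ler_nat supp_size_diff.
have b2 : (supp_size g)%:R <= (supp_size f)%:R + k :> R.
  by rewrite /k supp_size_diffC -natrD ler_nat supp_size_diff.
have := cut_ge t f; have := cut_le t f; have := cut_ge u g; have := cut_le u g.
rewrite -/c -/d; have /andP[t0 t1] := clamp01P t; have := clamp01_lipschitz t u.
set T := clamp01 t in t0 t1 *; set U := clamp01 u.
set S := (supp_size f)%:R in b1 b2 *; set S' := (supp_size g)%:R in b1 b2 *.
have S'0 : 0 <= S' by []. have k0 : 0 <= k by [].
move=> TU c1 c2 c3 c4.
have e1 : `|T * S - U * S'| <= k + `|t - u| * S'.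
  have -> : T * S - U * S' = T * (S - S') + (T - U) * S' by lra.
  rewrite (le_trans (ler_normD _ _))// !normrM (ger0_norm t0) (ger0_norm S'0).
  rewrite lerD ?ler_wpM2r// (le_trans (ler_piMl _ t1))// ler_norml.
  by apply/andP; split; lra.
have e2 : `|(supp_count g d)%:R - (supp_count g c)%:R| <= 2 * k + `|t - u| * S' + 1 :> R.
  by move: e1; rewrite !ler_norml => /andP[? ?]; apply/andP; split; lra.
lra.
Qed.

End contraction.

(** * Classes of sequences in the cone *)

Local Open Scope classical_set_scope.
Local Open Scope ring_scope.

Section cone_class.
Context (R : realType) (omega : np_ultrafilter) (s : scaling_sequence R omega).

Lemma scaling_lt (C : R) : \forall n \near npuf omega, C < s n.
Proof. by have /cvgryPgt := scaling_cvg s; apply. Qed.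

Lemma inv_scaling_cvg : (s n)^-1 @[n --> npuf omega] --> (0 : R).
Proof.
apply/gtr0_cvgV0; last exact: scaling_cvg.
by apply: nearW => n; exact: scaling_gt0.
Qed.

Context (G : groupType) (N : conj_norm R G).
Implicit Types x y : nat -> G.

(* Inadmissible sequences are sent to the class of the unit. *)
Definition cone_class x : Cone s N := cone_pi (insubd (adm_one s N) x).

Lemma adm_seq_insubd x : admissible s N x -> adm_seq (insubd (adm_one s N) x) = x.
Proof. by move=> ax; rewrite /adm_seq insubdK//; apply/mem_set. Qed.

Lemma cone_classP (a : Cone s N) : exists2 x, admissible s N x & a = cone_class x.
Proof.
elim/cone_ind : a => x; exists (adm_seq x); first exact: (admP x).
congr cone_pi; apply: adm_eq => n; rewrite adm_seq_insubd//; exact: (admP x).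
Qed.

Lemma cone_class_repr (a : Cone s N) : cone_class (adm_seq (repr a)) = a.
Proof.
rewrite -[RHS]reprK; congr cone_pi; apply: adm_eq => n.
rewrite adm_seq_insubd//; exact: (admP (repr a)).
Qed.

Lemma admissible_ge x : admissible s N x ->
  exists2 M : R, 0 <= M & forall n, N (x n) <= M * s n.
Proof.
move=> [M xM]; exists (Num.max 0 M) => [|n]; first by rewrite le_max lexx.
by rewrite -ler_pdivrMr ?scaling_gt0// le_max xM orbT.
Qed.

Lemma admissible1 : admissible s N (fun=> 1%g).
Proof. by exists 0 => n; rewrite cnorm1 mul0r. Qed.

Lemma admissibleM x y : admissible s N x -> admissible s N y ->
  admissible s N (fun n => x n * y n)%g.
Proof.
move=> ax ay; rewrite -[x]adm_seq_insubd// -[y]adm_seq_insubd//.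
exact/set_mem/adm_mul_subproof.
Qed.

Lemma admissibleV x : admissible s N x -> admissible s N (fun n => (x n)^-1)%g.
Proof.
by move=> ax; rewrite -[x]adm_seq_insubd//; exact/set_mem/adm_inv_subproof.
Qed.

Lemma cone_class_eqP x y : admissible s N x -> admissible s N y ->
  cone_class x = cone_class y <->
  N (x n / y n)%g / s n @[n --> npuf omega] --> (0 : R).
Proof.
move=> ax ay; split => [/cone_piP/asboolP|xy].
  by rewrite /scaled_dist !adm_seq_insubd.
by apply/cone_piP/asboolP; rewrite /scaled_dist !adm_seq_insubd.
Qed.

(** An error bounded on an [omega]-large set vanishes after division by [s n]. *)
Lemma cone_class_near (C : R) x y : admissible s N x -> admissible s N y ->
  (\forall n \near npuf omega, N (x n / y n)%g <= C) -> cone_class x = cone_class y.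
Proof.
move=> ax ay xyC; apply/cone_class_eqP => //.
apply: (@squeeze_cvgr _ _ _ _ (fun=> 0) (fun n => C * (s n)^-1)).
- near=> n; rewrite divr_ge0 ?cnorm_ge0//= ?(ltW (scaling_gt0 s n))//.
  by rewrite ler_pM2r ?invr_gt0 ?scaling_gt0//; near: n.
- exact: cvg_cst.
- by rewrite -(mulr0 C); apply: cvgMr; exact: inv_scaling_cvg.
Unshelve. all: by end_near. Qed.

Lemma cone_class1 : cone_class (fun=> 1%g) = 1%g.
Proof.
congr cone_pi; apply: adm_eq => n; rewrite adm_seq_insubd//; exact: admissible1.
Qed.

Lemma cone_classM x y : admissible s N x -> admissible s N y ->
  cone_class (fun n => x n * y n)%g = (cone_class x * cone_class y)%g.
Proof.
move=> ax ay; rewrite [RHS]cone_mulE; congr cone_pi; apply: adm_eq => n.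
by rewrite /adm_mul {2}/adm_seq /= !adm_seq_insubd//; exact: admissibleM.
Qed.

Lemma cone_classV x : admissible s N x ->
  cone_class (fun n => (x n)^-1)%g = (cone_class x)^-1%g.
Proof.
move=> ax; rewrite [RHS]cone_invE; congr cone_pi; apply: adm_eq => n.
by rewrite /adm_inv {2}/adm_seq /= !adm_seq_insubd//; exact: admissibleV.
Qed.

Lemma admissibleJ x y : admissible s N x -> admissible s N y ->
  admissible s N (fun n => x n ^ y n)%g.
Proof.
by move=> ax ay; exact: (admissibleM (admissibleV ay) (admissibleM ax ay)).
Qed.

Lemma cone_classJ x y : admissible s N x -> admissible s N y ->
  cone_class (fun n => x n ^ y n)%g = (cone_class x ^ cone_class y)%g.
Proof.
move=> ax ay; rewrite conjgE -(cone_classV ay) -(cone_classM ax ay).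
by rewrite -(cone_classM (admissibleV ay) (admissibleM ax ay)).
Qed.

Lemma admissibleR x y : admissible s N x -> admissible s N y ->
  admissible s N (fun n => [~ x n, y n])%g.
Proof.
by move=> ax ay; exact: (admissibleM (admissibleV ax) (admissibleJ ax ay)).
Qed.

Lemma cone_classR x y : admissible s N x -> admissible s N y ->
  cone_class (fun n => [~ x n, y n])%g = [~ cone_class x, cone_class y]%g.
Proof.
move=> ax ay; rewrite commgEl -(cone_classJ ax ay) -(cone_classV ax).
by rewrite -(cone_classM (admissibleV ax) (admissibleJ ax ay)).
Qed.

Lemma mdist_cone_class x y : admissible s N x -> admissible s N y ->
  N (x n / y n)%g / s n @[n --> npuf omega] --> mdist (cone_class x) (cone_class y).
Proof.
move=> ax ay; rewrite /mdist/= cone_distE.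
have := @scaled_dist_cvg _ _ s _ N (insubd (adm_one s N) x) (insubd (adm_one s N) y).
by rewrite /scaled_dist !adm_seq_insubd.
Qed.

End cone_class.

(** * Lipschitz maps between cones *)

Section cone_comparison.
Context (R : realType) (omega : np_ultrafilter) (s : scaling_sequence R omega).
Context (G G' : groupType) (N : conj_norm R G) (N' : conj_norm R G').

Lemma admissible_le (L : R) (x : nat -> G) (x' : nat -> G') : 0 <= L ->
  (forall n, N' (x' n) <= L * N (x n)) -> admissible s N x -> admissible s N' x'.
Proof.
move=> L0 xx' [M xM]; exists (L * M) => n.
rewrite (le_trans _ (ler_wpM2l L0 (xM n)))// mulrA ler_pM2r//.
by rewrite invr_gt0 scaling_gt0.
Qed.

(** In the limit the linear error [D * s n] survives as [D] and the bounded error [B] disappears.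
    This serves both the comparison of cones, with [D = 0], and the homotopy. *)
Lemma mdist_cone_class_le (L D B : R) (x y : nat -> G) (x' y' : nat -> G') :
  admissible s N x -> admissible s N y ->
  admissible s N' x' -> admissible s N' y' ->
  (forall n, N' (x' n / y' n)%g <= L * N (x n / y n)%g + D * s n + B) ->
  mdist (cone_class s N' x') (cone_class s N' y') <=
  L * mdist (cone_class s N x) (cone_class s N y) + D.
Proof.
move=> ax ay ax' ay' le.
have c := mdist_cone_class ax ay; have c' := mdist_cone_class ax' ay'.
have lim0 : L * (N (x n / y n)%g / s n) + D + B * (s n)^-1 @[n --> npuf omega]
    --> L * mdist (cone_class s N x) (cone_class s N y) + D + B * 0.
  apply: cvgD; last by apply: cvgMr; exact: inv_scaling_cvg.
  by apply: cvgD; [exact: cvgMr|exact: cvg_cst].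
rewrite mulr0 addr0 in lim0.
rewrite -(cvg_lim _ c')// -(cvg_lim _ lim0)//; apply: ler_lim.
- by apply/cvg_ex; eexists; exact: c'.
- by apply/cvg_ex; eexists; exact: lim0.
apply: nearW => n; have s0 := scaling_gt0 s n.
rewrite ler_pdivrMr// (le_trans (le n))// !mulrDl -!mulrA mulVf ?mulr1//.
exact: lt0r_neq0.
Qed.

End cone_comparison.

(** Applied termwise, [phi] is Lipschitz in both directions on admissible sequences, hence
    independent of representatives and injective on the cone; it is onto because the bounded error
    in approximating [g'] disappears. *)
Lemma same_cone_hom (R : realType) (omega : np_ultrafilter)
    (s : scaling_sequence R omega) (G G' : groupType)
    (N : conj_norm R G) (N' : conj_norm R G') (phi : G -> G') (L : R) :
  {morph phi : g h / (g * h)%g} -> 0 < L ->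
  (forall g, N' (phi g) <= L * N g) -> (forall g, N g <= L * N' (phi g)) ->
  (forall g', exists g, N' (phi g) <= L * N' g' /\ N' (phi g / g')%g <= L) ->
  same_cone s N N'.
Proof.
move=> phiM L0 phi_le phi_ge phi_onto; have L0' := ltW L0.
have phi1 : phi 1%g = 1%g.
  by apply: (@mulgI _ (phi 1%g)); rewrite -phiM !mulg1.
have phiV g : phi g^-1%g = (phi g)^-1%g.
  by apply: (@mulgI _ (phi g)); rewrite -phiM !mulgV.
have phiA x : admissible s N x -> admissible s N' (phi \o x).
  by apply: (admissible_le L0') => n; exact: phi_le.
pose f (a : Cone s N) := cone_class s N' (phi \o adm_seq (repr a)).
have f_lip x y : admissible s N x -> admissible s N y ->
    mdist (cone_class s N' (phi \o x)) (cone_class s N' (phi \o y)) <=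
    L * mdist (cone_class s N x) (cone_class s N y).
  move=> ax ay; rewrite -[leRHS]addr0.
  apply: (@mdist_cone_class_le _ _ _ _ _ _ _ _ _ 0) => //; [exact: phiA|exact: phiA|].
  by move=> n; rewrite mul0r !addr0 /= -phiV -phiM.
have f_colip x y : admissible s N x -> admissible s N y ->
    mdist (cone_class s N x) (cone_class s N y) <=
    L * mdist (cone_class s N' (phi \o x)) (cone_class s N' (phi \o y)).
  move=> ax ay; rewrite -[leRHS]addr0.
  apply: (@mdist_cone_class_le _ _ _ _ _ _ _ _ _ 0) => //; [exact: phiA|exact: phiA|].
  by move=> n; rewrite mul0r !addr0 /= -phiV -phiM.
have fE x : admissible s N x -> f (cone_class s N x) = cone_class s N' (phi \o x).
  move=> ax; apply: mdist_positivity; apply/eqP; rewrite eq_le mdist_ge0 andbT.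
  rewrite (le_trans (f_lip _ _ (admP _) ax))//.
  by rewrite cone_class_repr mdistxx mulr0.
have f_bil a b : L^-1 * mdist a b <= mdist (f a) (f b) <= L * mdist a b.
  have [x ax ->] := cone_classP a; have [y ay ->] := cone_classP b.
  by rewrite !fE// ler_pdivrMl// f_lip// f_colip.
exists f; split; last by exists L.
- move=> a b; have [x ax ->] := cone_classP a; have [y ay ->] := cone_classP b.
  have axy := admissibleM ax ay.
  rewrite -(cone_classM ax ay) !fE// -(cone_classM (phiA _ ax) (phiA _ ay)).
  by congr cone_class; apply/funext => n /=; rewrite phiM.
- have f_inj : injective f.
    move=> a b fab; apply: mdist_positivity; apply/eqP; rewrite eq_le mdist_ge0 andbT.
    have /andP[+ _] := f_bil a b.
    by rewrite fab mdistxx ler_pdivrMl// mulr0.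
  have f_surj b : exists a, f a = b.
    have [y ay ->] := cone_classP b; have [x xP] := choice (fun n => phi_onto (y n)).
    have ax' : admissible s N' (phi \o x).
      by apply: admissible_le L0' _ ay => n; exact: (xP n).1.
    have ax : admissible s N x by apply: admissible_le L0' _ ax' => n; exact: phi_ge.
    exists (cone_class s N x); rewrite fE//; apply: (@cone_class_near _ _ _ _ _ L) => //.
    by apply: nearW => n; exact: (xP n).2.
  have [g gK] := choice f_surj; exists g => [a|//]; apply: f_inj; exact: gK.
Qed.

(** * Comparison of norms *)

Lemma even_ptransp (P : seq (nat * nat)) : {in P, forall p, p.1 != p.2} ->
  ~~ odd (size P) -> even_Sinf (ptransp P).
Proof. by move=> nP eP; apply/asboolP; exists P. Qed.

(* No claim is made that the alternative is exclusive: the well-definedness of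
   the sign is not needed. *)
Lemma even_or_odd (f : Sinf) (a b : nat) : a != b ->
  even_Sinf f \/ even_Sinf (transp (a, b) * f)%g.
Proof.
move=> ab; have [P [_ nP ->]] := transp_decomposition f.
have [oP|eP] := boolP (odd (size P)); [right|by left; exact: even_ptransp].
rewrite -[(_ * _)%g](big_cons _ _ (a, b) P xpredT); apply: even_ptransp.
  by move=> p; rewrite inE => /predU1P[->|/nP].
by rewrite /= oP.
Qed.

Lemma even_move_below (l : seq nat) : exists h : Sinf,
  even_Sinf h /\ {in l, forall n, (h n < size l)%N}.
Proof.
pose t := iota 0 (size (undup l)).
have [|h [hl _]] := @seq_perm (undup l) t (undup_uniq l) (iota_uniq _ _).
  by rewrite size_iota.
have hlt : {in l, forall n, (h n < size l)%N}.
  move=> n; rewrite -mem_undup => /(map_f h); rewrite hl mem_iota /= add0n.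
  by move=> /leq_trans; apply; exact: size_undup.
have [eh|eh] := @even_or_odd h (size l) (size l).+1 (ltac:(by rewrite neq_ltn leqnn)).
  by exists h.
(* The correcting transposition exchanges two points outside the range below [size l] that contains
   the image of [l]. *)
exists (transp (size l, (size l).+1) * h)%g; split => // n /hlt nl.
by rewrite SinfM transpE /= !ltn_eqF// ltnW.
Qed.

(** * Groups embedded in [Sinf] with image containing all even permutations *)

Section even_image.
Context (G : groupType) (phi : G -> Sinf).
Context (phiM : {morph phi : g h / (g * h)%g}) (phi_inj : injective phi).
Context (phi_even : forall f, even_Sinf f -> exists g, phi g = f).

Let phi1 : phi 1%g = 1%g.
Proof. by apply: (@mulgI _ (phi 1%g)); rewrite -phiM !mulg1. Qed.

Let phiV g : phi g^-1%g = (phi g)^-1%g.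
Proof. by apply: (@mulgI _ (phi g)); rewrite -phiM !mulgV. Qed.

Let phiJ g h : phi (g ^ h)%g = (phi g ^ phi h)%g.
Proof. by rewrite !conjgE !phiM phiV. Qed.

Lemma same_cone_even_image (R : realType) (omega : np_ultrafilter)
    (s : scaling_sequence R omega) (N : conj_norm R G) (L M : nat) :
  (forall g, (supp_size (phi g))%:R <= L%:R * N g) ->
  (forall g, N g <= M%:R * (supp_size (phi g))%:R) ->
  same_cone s N (supp_norm R).
Proof.
move=> le ge; apply: (@same_cone_hom _ _ _ _ _ _ _ phi (L + M + 3)%:R) => //.
- move=> g; rewrite (le_trans (le g))// ler_wpM2r ?cnorm_ge0// ler_nat.
  by rewrite -addnA leq_addr.
- move=> g; rewrite (le_trans (ge g))// ler_wpM2r ?cnorm_ge0// ler_nat.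
  by rewrite addnAC leq_addl.
move=> f; have [/phi_even[g gf]|/phi_even[g gf]] := @even_or_odd f 0%N 1%N isT.
  exists g; rewrite gf mulgV cnorm1; split => //.
  by rewrite ler_peMl ?cnorm_ge0// ler1n addnS.
(* At the unit the first bound leaves no room for an extra transposition, so [g = 1] is taken.
   Otherwise the two extra points are at most twice [supp_size f], whence the 3 in the constant. *)
have [f1|f1] := eqVneq f 1%g.
  by exists 1%g; rewrite phi1 f1 mulgV cnorm1 mulr0.
have t2 : (supp_size (transp (0%N, 1%N)) <= 2)%N.
  exact: supp_size_le (@supp_transp _).
exists g; rewrite gf mulgK; split; last first.
  by rewrite ler_nat (leq_trans t2)// addnS addnS ltnS.
rewrite -natrM ler_nat (leq_trans (supp_sizeM _ _))//.
have : (0 < supp_size f)%N.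
  by rewrite lt0n; apply: contra f1 => /eqP/supp_size0/eqP.
nia.
Qed.

Context (T : fin_conj_genset G).

Lemma word_lengthM g h :
  (word_length T (g * h)%g <= word_length T g + word_length T h)%N.
Proof. by apply: word_length_le; apply: is_wordM; exact: word_lengthP. Qed.

Lemma word_lengthJ g h : word_length T (g ^ h)%g = word_length T g.
Proof.
apply: word_length_eq => m; split; last exact: is_wordJ.
by move=> /(is_wordJ (h^-1)%g); rewrite conjgK.
Qed.

(** Support size is constant on conjugacy classes, so finitely many classes give a uniform bound per
    letter. *)
Lemma supp_size_word_length :
  exists L : nat, forall g, (supp_size (phi g) <= L * word_length T g)%N.
Proof.
have [C [finC TE]] := gens_conj T.
exists (\max_(c <- fset_set C) supp_size (phi c))%N => g.
have [t [<- tT ->]] := word_lengthP T g.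
elim: t tT => [|x t IH] tT; first by rewrite big_nil phi1 supp_size1.
rewrite big_cons phiM /= mulnS (leq_trans (supp_sizeM _ _))// leq_add//; last first.
  by apply: IH => y yt; apply: tT; rewrite inE yt orbT.
have : gens T x by apply: tT; rewrite inE eqxx.
rewrite TE => -[c Cc [h _ <-]]; rewrite phiJ supp_sizeJ.
apply: (leq_bigmax_seq (F := fun c => supp_size (phi c))) => //.
by rewrite in_fset_set// inE.
Qed.

(* An even permutation conjugates any two transpositions into permutations of
   the four points below 4, so only finitely many elements are involved. *)
Lemma word_length_transp2 : exists B : nat, forall p q g,
  phi g = (transp p * transp q)%g -> (word_length T g <= B)%N.
Proof.
pose V := ('I_4 * 'I_4 * ('I_4 * 'I_4))%type.
pose w (v : V) : Sinf := (transp (val v.1.1, val v.1.2) * transp (val v.2.1, val v.2.2))%g.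
(* By injectivity [w v] has at most one preimage; with none, 0 serves as bound. *)
have wb v : exists b : nat, forall g, phi g = w v -> (word_length T g <= b)%N.
  have [[g gv]|nv] := pselect (exists g, phi g = w v).
    by exists (word_length T g) => h; rewrite -gv => /phi_inj ->.
  by exists 0%N => g gv; case: nv; exists g.
have [b bP] := choice wb; exists (\max_(v : V) b v)%N => p q g gpq.
have [h0 [/phi_even[h <-] hlt]] := even_move_below [:: p.1; p.2; q.1; q.2].
have h4 n : n \in [:: p.1; p.2; q.1; q.2] -> exists i : 'I_4, phi h n = val i.
  by move=> /hlt n4; exists (Ordinal n4).
have [i1 e1] := h4 p.1 (ltac:(by rewrite !inE eqxx ?orbT)).
have [i2 e2] := h4 p.2 (ltac:(by rewrite !inE eqxx ?orbT)).
have [i3 e3] := h4 q.1 (ltac:(by rewrite !inE eqxx ?orbT)).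
have [i4 e4] := h4 q.2 (ltac:(by rewrite !inE eqxx ?orbT)).
rewrite -(word_lengthJ g h^-1%g).
apply: leq_trans (bP ((i1, i2), (i3, i4)) _ _) (leq_bigmax _).
rewrite phiJ phiV gpq conjMg !transpJ !invgK /w /=.
by rewrite -e1 -e2 -e3 -e4.
Qed.

(** Transpositions are split off in pairs, because products of two are even and therefore lift to
    the group. *)
Lemma word_length_supp_size :
  exists M : nat, forall g, (word_length T g <= M * supp_size (phi g))%N.
Proof.
have [B BP] := word_length_transp2; exists B => g.
have [P [sP nP gP]] := transp_decomposition (phi g).
rewrite (leq_trans _ (leq_mul (leqnn B) sP))//.
have [n] := ubnP (size P); elim: n P nP g gP {sP} => // n IH [|p [|q P]] nP g gP sP.
- have -> : g = 1%g by apply: phi_inj; rewrite gP phi1 /ptransp big_nil.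
  by rewrite muln0 word_length_le//; exact: is_word1.
(* A leftover transposition is paired with the trivial [transp (0, 0)]. *)
- rewrite muln1; apply: (BP p (0%N, 0%N)).
  by rewrite gP /ptransp big_seq1 transp_id mulg1.
- have [|a aE] := phi_even (f := (transp p * transp q)%g).
    rewrite (_ : (_ * _)%g = ptransp [:: p; q]); last first.
      by rewrite /ptransp big_cons big_seq1.
    apply: even_ptransp => // x; rewrite !inE => xpq; apply: nP.
    by rewrite !inE orbA xpq.
  rewrite -(mulVKg a g) (leq_trans (word_lengthM _ _))//.
  rewrite (leq_trans (leq_add (BP _ _ _ aE) (IH P _ (a^-1 * g)%g _ _)))//.
  + by move=> x xP; apply: nP; rewrite !inE xP !orbT.
  + by rewrite phiM phiV aE gP /ptransp !big_cons invgM -!mulgA !mulKg.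
  + by move: sP; rewrite ltnS => /ltnW.
  + by rewrite /= -mulnS leq_mul.
Qed.

Lemma same_cone_word_norm (R : realType) (omega : np_ultrafilter)
  (s : scaling_sequence R omega) : same_cone s (word_norm R T) (supp_norm R).
Proof.
have [L LP] := supp_size_word_length; have [M MP] := word_length_supp_size.
by apply: (@same_cone_even_image _ _ _ _ L M) => g; rewrite -natrM ler_nat.
Qed.

End even_image.

Lemma same_cones (R : realType) (omega : np_ultrafilter)
    (s : scaling_sequence R omega) :
  [/\ same_cone s (supp_norm R) (supp_norm R),
      same_cone s (supp_norm_Ainf R) (supp_norm R),
      (forall T : fin_conj_genset Sinf,
         same_cone s (word_norm R T) (supp_norm R)) &
      (forall T : fin_conj_genset Ainf,
         same_cone s (word_norm R T) (supp_norm R))].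
Proof.
have idE f : even_Sinf f -> exists g : Sinf, id g = f by exists f.
have valE f : even_Sinf f -> exists g : Ainf, val g = f by move=> ef; exists (MkAinf ef).
have valM' : {morph (val : Ainf -> Sinf) : g h / (g * h)%g} by move=> g h; exact: valM.
split.
- by apply: (@same_cone_even_image _ id _ idE _ _ _ _ 1 1) => // g; rewrite mul1r.
- by apply: (@same_cone_even_image _ val valM' valE _ _ _ _ 1 1) => g; rewrite mul1r.
- by move=> T; exact: (@same_cone_word_norm _ id).
- by move=> T; apply: (same_cone_word_norm valM' val_inj valE).
Qed.

(** * The cone of the support norm *)

Section support_cone.
Context (R : realType) (omega : np_ultrafilter) (s : scaling_sequence R omega).
Local Notation adm := (admissible s (supp_norm R)).
Local Notation cls := (cone_class s (supp_norm R)).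
Implicit Types x y f g : nat -> Sinf.

Lemma admissible_supp_le (L : nat) f g :
  (forall n, (supp_size (g n) <= L * supp_size (f n))%N) -> adm f -> adm g.
Proof.
move=> fg; apply: (@admissible_le _ _ _ _ _ _ _ L%:R) => // n.
by rewrite -natrM ler_nat.
Qed.

Lemma admissible_supp_sub f g :
  (forall n, {subset supp (g n) <= supp (f n)}) -> adm f -> adm g.
Proof.
by move=> fg; apply: (@admissible_supp_le 1) => n; rewrite mul1n; exact: supp_size_le.
Qed.

Lemma support_cone_commutator (a : Cone s (supp_norm R)) :
  exists b c : Cone s (supp_norm R), a = [~ b, c]%g.
Proof.
have [f af ->] := cone_classP a.
have [x xP] := choice (fun n => near_commutator (f n)).
have [y xyP] := choice xP.
have ax : adm x by apply: admissible_supp_sub af => n; have [] := xyP n.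
have ay : adm y by apply: admissible_supp_sub af => n; have [] := xyP n.
exists (cls x), (cls y); rewrite -cone_classR//.
apply: (@cone_class_near _ _ _ _ _ 2) => //; first exact: admissibleR.
by apply: nearW => n; have [_ _] := xyP n; rewrite ler_nat.
Qed.

Lemma mdist_shrink_le (t u M : R) x y : adm x -> adm y ->
  (forall n, supp_norm R (y n) <= M * s n) ->
  mdist (cls (fun n => shrink t (x n))) (cls (fun n => shrink u (y n))) <=
  5 * mdist (cls x) (cls y) + 2 * `|t - u| * M.
Proof.
move=> ax ay yM; have ac v z : adm z -> adm (fun n => shrink v (z n)).
  by apply: admissible_supp_sub => n; exact: supp_shrink.
apply: (@mdist_cone_class_le _ _ _ _ _ _ _ _ _ 6) => //; [exact: ac|exact: ac|].
(* [shrink_lipschitz] measures [g^-1 * f] and the metric [f * g^-1]; their norms agree by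
   conjugation invariance. *)
move=> n; rewrite cnorm_mulC [supp_norm R (x n / y n)%g]cnorm_mulC.
rewrite (le_trans (shrink_lipschitz t u (x n) (y n)))// lerD2r lerD2l -(mulrA _ M).
by rewrite ler_wpM2l//; exact: yM.
Qed.

Lemma support_cone_contractible : contractible R (Cone s (supp_norm R)).
Proof.
(* [H] uses chosen representatives; the estimate [mdist_shrink_le] holds for arbitrary ones and so
   absorbs the choice. *)
pose H (p : R * Cone s (supp_norm R)) :=
  cls (fun n => shrink p.1 (adm_seq (repr p.2) n)).
exists 1%g, H; split; last first.
  move=> a; split; first by rewrite /H -[RHS]cone_class_repr;
    congr cone_class; apply/funext => n; rewrite shrink0.
  rewrite /H -cone_class1; congr cone_class; apply/funext => n; exact: shrink1.
apply: continuous_subspaceT => -[t a].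
have [M M0 aM] := admissible_ge (admP (repr a)).
apply/metricType_numDomainType.cvgrPdist_lt => e e0.
(* The two radii make each term of [mdist_shrink_le] less than [e / 2]; [M + 1] avoids dividing by
   zero. *)
have d0 : 0 < e / (4 * (M + 1)) by rewrite divr_gt0// mulr_gt0// ltr_wpDl.
have d1 : 0 < e / 10 by rewrite divr_gt0.
exists (ball t (e / (4 * (M + 1))), ball a (e / 10)).
  by split; exact: nbhsx_ballx.
move=> [u b] [/= tu]; rewrite ballEmdist /= => ab.
have := mdist_shrink_le u t (admP (repr b)) (admP (repr a)) aM.
rewrite !cone_class_repr metric_sym (metric_sym b a) => /le_lt_trans; apply.
move: tu; rewrite /ball /= distrC ltr_pdivlMr ?mulr_gt0 ?ltr_wpDl// => tu.
have : `|u - t| * M <= `|u - t| * (M + 1) by rewrite ler_wpM2l// lerDl.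
lra.
Qed.

(** Nontriviality becomes linear growth of the support along [omega]; half the distance to the unit
    serves as [c]. *)
Lemma cone_class_neq1 f : adm f -> cls f <> 1%g <->
  exists2 c : R, 0 < c & \forall n \near npuf omega, c * s n <= (supp_size (f n))%:R.
Proof.
move=> af; have := mdist_cone_class af (admissible1 s (supp_norm R)).
rewrite cone_class1; under eq_fun do rewrite invg1 mulg1.
set d := mdist _ _ => fd; split => [f1|[c c0 cf] f1].
  have d0 : 0 < d by rewrite mdist_gt0; apply/eqP.
  exists (d / 2); first by rewrite divr_gt0.
  have d2 : d / 2 < d by rewrite ltr_pdivrMr// ltr_pMr// ltr1n.
  move/cvgr_gt: fd => /(_ _ d2); apply: filterS => n.
  by rewrite ltr_pdivlMr ?scaling_gt0// => /ltW.
move: fd; rewrite /d f1 mdistxx => /cvgr_lt/(_ _ c0) fc.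
have [n [/= + cn]] := filter_ex (filterI fc cf).
by rewrite ltr_pdivrMr ?scaling_gt0// ltNge cn.
Qed.

Lemma Sinf_supp_size (m : nat) :
  exists f : Sinf, (m <= supp_size f)%N /\ (supp_size f <= 2 * m)%N.
Proof.
have [|f [fm fS]] := @seq_perm (iota 0 m) (iota m m) (iota_uniq _ _) (iota_uniq _ _).
  by rewrite !size_iota.
exists f; split; last first.
  by rewrite (leq_trans (supp_size_le fS))// size_cat !size_iota mul2n addnn.
rewrite -{1}(size_iota 0 m); apply: le_supp_size (iota_uniq _ _) _ => n nm.
have := map_f f nm; rewrite fm mem_supp; move: nm; rewrite !mem_iota /= add0n.
by move=> nm /andP[mf _]; rewrite gtn_eqF// (leq_trans nm).
Qed.

Lemma support_cone_nontrivial : exists a : Cone s (supp_norm R), a <> 1%g.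
Proof.
have [f fP] := choice (fun n => Sinf_supp_size (Num.truncn (s n))).
have af : adm f.
  exists 2 => n; have s0 := scaling_gt0 s n; rewrite ler_pdivrMr//.
  have [_ f2] := fP n; rewrite (le_trans (y := (2 * Num.truncn (s n))%:R))//.
    by rewrite ler_nat.
  by rewrite natrM ler_wpM2l// truncn_le// ltW.
exists (cls f); apply/(cone_class_neq1 af); exists 2^-1 => //.
(* Beyond 2, truncation loses at most half of [s n]. *)
near=> n; have s2 : 2 < s n by near: n; exact: scaling_lt.
have [fm _] := fP n; rewrite (le_trans (y := (Num.truncn (s n))%:R)) ?ler_nat//.
have := truncnS_gt (s n); rewrite -natr1; lra.
Unshelve. all: by end_near. Qed.

(** * Normal subgroups containing a given class *)

Section normal_subgroup.
Context (H : set (Cone s (supp_norm R))) (nH : is_normal_subgroup H).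
Context (g : nat -> Sinf) (ag : adm g) (Hg : H (cls g)).

Let HM a b : H a -> H b -> H (a * b)%g. Proof. by case: nH => -[_ + _] _; exact. Qed.
Let HV a : H a -> H a^-1%g. Proof. by case: nH => -[_ _ +] _; exact. Qed.
Let HJ a b : H a -> H (a ^ b)%g. Proof. by case: nH => _; exact. Qed.
Let H1 : H 1%g. Proof. by case: nH => -[]. Qed.
Let HR a b : H a -> H [~ a, b]%g.
Proof. by move=> Ha; rewrite commgEl; apply: HM (HV Ha) (HJ _ Ha). Qed.

Lemma normal_small_supp f : adm f ->
  (\forall n \near npuf omega, (3 * supp_size (f n) <= supp_size (g n))%N) -> H (cls f).
Proof.
move=> af fg.
have /choice[x /choice[y /choice[z xyz]]] : forall n, exists x y z : Sinf,
    [/\ (supp_size x <= supp_size (f n))%N, (supp_size y <= supp_size (f n))%N,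
        (supp_size z <= 2 * supp_size (f n))%N &
        (3 * supp_size (f n) <= supp_size (g n))%N ->
        (supp_size (f n / [~ [~ g n, x], y] ^ z)%g <= 2)%N].
  move=> n; have [fgn|fgn] := leqP (3 * supp_size (f n)) (supp_size (g n)).
    by have [x [y [z [? ? ? ?]]]] := near_double_commutator fgn; exists x, y, z.
  (* Trivial defaults keep the size bounds valid for every [n], as admissibility requires. *)
  by exists 1%g, 1%g, 1%g; rewrite supp_size1.
have ax : adm x by apply: (@admissible_supp_le 1) af => n; rewrite mul1n; have [] := xyz n.
have ay : adm y by apply: (@admissible_supp_le 1) af => n; rewrite mul1n; have [] := xyz n.
have az : adm z by apply: (@admissible_supp_le 2) af => n; have [] := xyz n.
have agx := admissibleR ag ax; have agxy := admissibleR agx ay.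
have -> : cls f = cls (fun n => [~ [~ g n, x n], y n] ^ z n)%g.
  apply: (@cone_class_near _ _ _ _ _ 2) => //; first exact: (admissibleJ agxy az).
  by apply: filterS fg => n fgn; have [_ _ _ /(_ fgn)] := xyz n; rewrite ler_nat.
rewrite (cone_classJ agxy az) (cone_classR agx ay) (cone_classR ag ax).
exact/HJ/HR/HR.
Qed.

(** A slice of a sixth of [supp_size g] transpositions moves at most a third as many points as [g],
    so [normal_small_supp] applies to each of [K] slices. *)
Lemma normal_ptransp (K : nat) (P : nat -> seq (nat * nat)) :
  (forall n, (size (P n) <= K * (supp_size (g n) %/ 6))%N) ->
  H (cls (fun n => ptransp (P n))).
Proof.
have aP k (Q : nat -> seq (nat * nat)) :
    (forall n, (size (Q n) <= k * (supp_size (g n) %/ 6))%N) ->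
    adm (fun n => ptransp (Q n)).
  move=> Qk; apply: (@admissible_supp_le k) ag => n.
  rewrite (leq_trans (ptransp_size _))//.
  have := Qk n; have := leq_divM (supp_size (g n)) 6; nia.
elim: K P => [|K IH] P PK.
  rewrite (_ : (fun n => _) = fun=> 1%g) ?cone_class1//.
  apply/funext => n; move: (PK n); rewrite leqn0 size_eq0 => /eqP ->.
  by rewrite /ptransp big_nil.
pose q n := (supp_size (g n) %/ 6)%N.
pose A n := take (q n) (P n); pose B n := drop (q n) (P n).
have Aq n : (size (A n) <= q n)%N by rewrite size_take_min geq_minl.
have Bq n : (size (B n) <= K * q n)%N.
  by rewrite size_drop leq_subLR -mulSn; exact: PK.
have aA : adm (fun n => ptransp (A n)) by apply: (aP 1%N) => n; rewrite mul1n; exact: Aq.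
have aB := aP _ _ Bq.
rewrite (_ : (fun n => _) = fun n => (ptransp (A n) * ptransp (B n))%g); last first.
  by apply/funext => n; rewrite -ptransp_cat cat_take_drop.
rewrite (cone_classM aA aB); apply: HM; last exact: IH.
apply: normal_small_supp => //; apply: nearW => n.
have := Aq n; have := ptransp_size (A n); rewrite /q.
have := leq_divM (supp_size (g n)) 6; lia.
Qed.

Lemma normal_setT : cls g <> 1%g -> H = [set: _].
Proof.
move=> /(cone_class_neq1 ag)[c c0 cg]; apply/seteqP; split => // a _.
have [f af ->] := cone_classP a; have [M M0 fM] := admissible_ge af.
have [P PP] := choice (fun n => transp_decomposition (f n)).
pose q n := (supp_size (g n) %/ 6)%N.
(* Once [s n > 12 / c], [q n] is at least [c * s n / 12]; since [size (P n)] is at most [M * s n],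
   any [K] above [12 * M / c] suffices. *)
pose K := (Num.truncn (12 * M / c)).+1.
(* [normal_ptransp] wants the bound for every [n]; the empty list replaces [P n] on the
   [omega]-negligible set where it fails. *)
pose Q n := if (size (P n) <= K * q n)%N then P n else [::].
have QK n : (size (Q n) <= K * q n)%N by rewrite /Q; case: ifP.
suff -> : cls f = cls (fun n => ptransp (Q n)) by exact: normal_ptransp QK.
have aQ : adm (fun n => ptransp (Q n)).
  apply: admissible_supp_sub af => n x; rewrite /Q; case: ifP => _.
    by have [_ _ <-] := PP n.
  by rewrite /ptransp big_nil (negPf (supp1 x)).
apply: (@cone_class_near _ _ _ _ _ 0) => //; near=> n.
have [sP _ fE] := PP n; rewrite /Q ifT; first by rewrite -fE mulgV cnorm1.
rewrite (leq_trans sP)// -(ler_nat R) (le_trans (fM n))// natrM.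
have cgn : c * s n <= (supp_size (g n))%:R by near: n.
have sn : 12 / c < s n by near: n; exact: scaling_lt.
have KM : 12 * M / c < K%:R by exact: truncnS_gt.
have gq : (supp_size (g n))%:R <= 6 * (q n)%:R + 6 :> R.
  rewrite -natrM -natrD ler_nat {1}(divn_eq (supp_size (g n)) 6) mulnC leq_add2l.
  by rewrite ltnW// ltn_pmod.
rewrite ltr_pdivrMr// in sn; rewrite ltr_pdivrMr// in KM.
have q0 : c * s n <= 12 * (q n)%:R by lra.
have : 12 * M * s n <= K%:R * (c * s n).
  by rewrite mulrA ler_wpM2r ?ltW ?scaling_gt0.
have : K%:R * (c * s n) <= K%:R * (12 * (q n)%:R) by rewrite ler_wpM2l.
lra.
Unshelve. all: by end_near. Qed.

End normal_subgroup.

Lemma support_cone_simple : simple_group (Cone s (supp_norm R)).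
Proof.
split; first exact: support_cone_nontrivial.
move=> H nH; have [[a Ha a1]|H1] := pselect (exists2 a, H a & a <> 1%g).
  right; have [g ag ga] := cone_classP a; rewrite ga in Ha a1.
  exact: (normal_setT nH ag Ha a1).
left; apply/seteqP; split => [a Ha|_ ->].
  by apply: contrapT => a1; apply: H1; exists a.
by case: nH => -[].
Qed.

End support_cone.

Theorem proposition5p1 (R : realType) :
  (forall (omega : np_ultrafilter) (s : scaling_sequence R omega),
     [/\ same_cone s (supp_norm R) (supp_norm R),
         same_cone s (supp_norm_Ainf R) (supp_norm R),
         (forall T : fin_conj_genset Sinf,
            same_cone s (word_norm R T) (supp_norm R)) &
         (forall T : fin_conj_genset Ainf,
            same_cone s (word_norm R T) (supp_norm R))]) /\
  (forall (omega : np_ultrafilter) (s : scaling_sequence R omega),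
     [/\ contractible R (Cone s (supp_norm R)),
         simple_group (Cone s (supp_norm R)) &
         forall g : Cone s (supp_norm R),
           exists x y : Cone s (supp_norm R), g = [~ x, y]%g]).
Proof.
split=> omega s; first exact: same_cones.
split; [exact: support_cone_contractible|exact: support_cone_simple|].
exact: support_cone_commutator.
Qed.
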